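(* Let $\varphi\in L^\infty$ be such that $K_1(\varphi)\neq\{0\}$, and let $\psi$ be a nonconstant inner function for which the subspace $E_{\varphi,\psi}:=K_1(\varphi)\cap\psi H^1$ is proximinal in $K_1(\varphi)$. Let $f\in K_1(\varphi)$ be such that the coset $f+E_{\varphi,\psi}$ has norm $1$ in $K_1(\varphi)/E_{\varphi,\psi}$. Then the following are equivalent: (i) $f+E_{\varphi,\psi}$ is an extreme point of $\mathrm{ball}\,(K_1(\varphi)/E_{\varphi,\psi})$; (ii) there is a function $h\in K_1(\varphi)$ with $\mathcal{M}(f;K_1(\varphi),E_{\varphi,\psi})=\{h\}$ and such that the inner factors of $h$ and $\overline{z\varphi h}$ are relatively prime.
   Context: $\mathbb{T}$ is the unit circle with normalized Haar measure $m$, $L^p=L^p(\mathbb{T},m)$, and $H^p=\{f\in L^p:\widehat f(k)=0\ \forall k<0\}$ (Hardy space), where $\widehat f(k)=\int_{\mathbb{T}}\bar\zeta^kf(\zeta)\,dm(\zeta)$; $z$ denotes the identity function $z(\zeta)=\zeta$ on $\mathbb{T}$. An inner function is $\psi\in H^\infty$ with $|\psi|=1$ a.e. on $\mathbb{T}$; every nonzero $H^1$ function factors as (inner)$\times$(outer), and its inner factor is the inner function in this factorization. For $\varphi\in L^\infty$, $K_1(\varphi):=\{f\in H^1:\ \overline{z\varphi f}\in H^1\}$ (the kernel in $H^1$ of the Toeplitz operator with symbol $\varphi$), a closed subspace of $H^1$ equipped with the norm $\|\cdot\|_1$. Two functions $u,v\in H^1$ have relatively prime inner factors if there is no nonconstant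 inner function $J$ with $u/J\in H^1$ and $v/J\in H^1$. For a Banach space $X$ and closed subspace $Y$: $X/Y$ carries the quotient norm $\|x+Y\|=\inf_{y\in Y}\|x+y\|$; $\mathcal{M}(x;X,Y):=\{\xi\in x+Y:\|\xi\|=\|x+Y\|_{X/Y}\}$; $Y$ is proximinal in $X$ if $\mathcal{M}(x;X,Y)\neq\emptyset$ for every $x\in X$. $\mathrm{ball}\,(Z)$ denotes the closed unit ball of a Banach space $Z$, and a point of it is extreme if it is not the midpoint of two distinct points of the ball. *)

(* Defs.v *)
From HB Require Import structures.
From mathcomp Require Import all_boot all_order all_algebra.
From mathcomp Require Import all_classical all_reals all_analysis.
From mathcomp Require Import complex.
Set Implicit Arguments. Unset Strict Implicit. Unset Printing Implicit Defensive.
Import Order.TTheory GRing.Theory Num.Theory.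
Local Open Scope classical_set_scope.
Local Open Scope ring_scope.

(* The unit circle T is parametrized by t in [0,1] via t |-> exp(2 pi i t);
   normalized Haar measure m on T corresponds to Lebesgue measure on [0,1].
   A function on T is represented as f : R -> R[i], read on [0,1]. *)
Section Circle.
Variable R : realType.
Local Notation C := R[i].
Local Notation mu := (@lebesgue_measure R).
Definition I01 : set R := `[0%R, 1%R].

Definition cmod (z : C) : R := Num.sqrt (complex.Re z ^+ 2 + complex.Im z ^+ 2).

Definition zpow (k : int) (t : R) : C :=
  Complex (cos (2 * pi * k%:~R * t)) (sin (2 * pi * k%:~R * t)).
Definition zid : R -> C := zpow 1.

Definition ae01 (P : R -> Prop) : Prop := {ae mu, forall t, I01 t -> P t}.

Definition cmeasurable (f : R -> C) : Prop :=
  measurable_fun I01 (fun t => complex.Re (f t)) /\ measurable_fun I01 (fun t => complex.Im (f t)).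

Definition L1 (f : R -> C) : Prop :=
  cmeasurable f /\ (\int[mu]_(t in I01) (cmod (f t))%:E < +oo)%E.

Definition Linf (f : R -> C) : Prop :=
  cmeasurable f /\ exists M : R, ae01 (fun t => cmod (f t) <= M).

Definition norm1 (f : R -> C) : R := \int[mu]_(t in I01) cmod (f t).

Definition fourier (f : R -> C) (k : int) : C :=
  Complex (\int[mu]_(t in I01) complex.Re (conjc (zpow k t) * f t))
          (\int[mu]_(t in I01) complex.Im (conjc (zpow k t) * f t)).

Definition H1 (f : R -> C) : Prop :=
  L1 f /\ forall k : int, k < 0 -> fourier f k = 0.

Definition Hinf (f : R -> C) : Prop :=
  Linf f /\ forall k : int, k < 0 -> fourier f k = 0.

Definition inner (psi : R -> C) : Prop :=
  Hinf psi /\ ae01 (fun t => cmod (psi t) = 1).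

Definition nonconstant (f : R -> C) : Prop :=
  ~ exists c : C, ae01 (fun t => f t = c).

Definition K1 (phi : R -> C) (f : R -> C) : Prop :=
  H1 f /\ H1 (fun t => conjc (zid t * phi t * f t)).

Definition mulH1 (psi : R -> C) (f : R -> C) : Prop :=
  exists g, H1 g /\ ae01 (fun t => f t = psi t * g t).

Definition Espace (phi psi : R -> C) (f : R -> C) : Prop :=
  K1 phi f /\ mulH1 psi f.

Definition qnorm (Y : (R -> C) -> Prop) (x : R -> C) : R :=
  inf [set r | exists y, Y y /\ r = norm1 (fun t => x t + y t)].

Definition Mset (Y : (R -> C) -> Prop) (x : R -> C) (xi : R -> C) : Prop :=
  Y (fun t => xi t - x t) /\ norm1 xi = qnorm Y x.

Definition proximinal (X Y : (R -> C) -> Prop) : Prop :=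
  forall x, X x -> exists xi, Mset Y x xi.

Definition extreme_coset (X Y : (R -> C) -> Prop) (x : R -> C) : Prop :=
  qnorm Y x <= 1 /\
  forall g1 g2, X g1 -> X g2 -> qnorm Y g1 <= 1 -> qnorm Y g2 <= 1 ->
    Y (fun t => x t - (g1 t + g2 t) / 2) -> Y (fun t => g1 t - g2 t).

Definition rel_prime_inner (u v : R -> C) : Prop :=
  ~ exists J, inner J /\ nonconstant J /\
      H1 (fun t => u t / J t) /\ H1 (fun t => v t / J t).

End Circle.

(* Main.v *)
(* A norm-one [h] in the Toeplitz kernel is extreme in the unit ball precisely when [h] and
   [v = conj (z phi h)] have no common inner divisor: equality in the triangle inequality
   turns [h = (g1 + g2) / 2] into [g1 - g2 = 2 r h] with [r] real and bounded, and then
   [r h] and [r v] lie in [H1], so the minimal inner denominator of [r] divides both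
   (it is nonconstant unless [r] is constant).  Conversely a common divisor [J] gives the
   perturbations [h (1 + s)], [h (1 - s)], [s = Re (b J)], of norm one for a suitable
   unimodular [b]; they differ by an element of [psi H1] only if [h] itself lies in
   [psi H1], because [1 + b^2 J^2] is outer.  In the quotient, extremality forces this for
   every minimizer, and two minimizers would make their midpoint non-extreme.

   Inner-outer factorization is avoided: inner functions and bounded outer multipliers are
   both obtained as minimal-norm elements of closed convex sets in (weighted) [L2], whose
   squared modulus is constant (times the weight) by the uniqueness of Fourier
   coefficients. *)
Require Import Defs.
From HB Require Import structures.
From mathcomp Require Import all_boot all_order all_algebra.
From mathcomp Require Import all_classical all_reals all_analysis.
From mathcomp Require Import complex.
From mathcomp Require Import measurable_realfun ring lra.
Set Implicit Arguments.
Unset Strict Implicit.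
Unset Printing Implicit Defensive.
Import Order.TTheory GRing.Theory Num.Theory.
Import numFieldNormedType.Exports.
Local Open Scope classical_set_scope.
Local Open Scope ring_scope.

(** The obstacle is integrability: [h] and its companion [v] are only in [H1], while minimal-norm
    arguments live in a Hilbert space, and even the product of an [H1] function with a bounded one
    is not known at the outset to stay in [H1]. The bridge is a family of bounded multipliers [F],
    minimizers for the weight [1 + eps |u|]: since [|F|^2 (1 + eps |u|)] is constant, [|F u|^2] is
    at most a multiple of [|u|], so [F u] is square-integrable, and [F] tends to 1 as [eps] tends to
    0. What shift-invariant subspaces give in [H2] then reaches [H1] by [L1] limits. The subspace
    argument also shows that a nonzero [H1] function vanishes only on a null set, which is what
    allows division by [h] in the definition of [r]. In the converse, the rotation [b] makes the
    integral of [s |h|] zero; with [|s| <= 1] this gives both perturbations exactly the norm of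
    [h]. *)

Section ComplexModulus.
Variable R : realType.
Local Notation C := R[i].
Implicit Types z w : C.

Lemma cmodE z : cmod z = Normc.normc z. Proof. by case: z. Qed.

Lemma cmodM z w : cmod (z * w) = cmod z * cmod w.
Proof. by rewrite !cmodE Normc.normcM. Qed.

Lemma cmodD z w : cmod (z + w) <= cmod z + cmod w.
Proof. by rewrite !cmodE; exact: le_normcD. Qed.

Lemma cmodN z : cmod (- z) = cmod z.
Proof. by rewrite !cmodE normcN. Qed.

Lemma cmod_ge0 z : 0 <= cmod z. Proof. exact: sqrtr_ge0. Qed.

Lemma cmod0 : cmod (0 : C) = 0. Proof. by rewrite cmodE Normc.normc0. Qed.

Lemma cmod_eq0 z : cmod z = 0 -> z = 0.
Proof. by rewrite cmodE; exact: Normc.eq0_normc. Qed.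

Lemma cmod_conj z : cmod (conjc z) = cmod z.
Proof. by case: z => a b; rewrite /cmod /= sqrrN. Qed.

Lemma cmod_real (x : R) : cmod (x%:C)%C = `|x|.
Proof. by rewrite /cmod /= expr0n /= addr0 sqrtr_sqr. Qed.

Lemma cmodV z : cmod z^-1 = (cmod z)^-1.
Proof. by rewrite !cmodE Normc.normcV. Qed.

Lemma cmod_sqr z : cmod z ^+ 2 = complex.Re z ^+ 2 + complex.Im z ^+ 2.
Proof. by rewrite sqr_sqrtr // addr_ge0 // sqr_ge0. Qed.

Lemma mulc_conj z : z * conjc z = ((cmod z ^+ 2)%:C)%C.
Proof.
rewrite cmod_sqr; case: z => a b; apply/eqP; rewrite eq_complex /=.
by apply/andP; split; apply/eqP; ring.
Qed.

Lemma Re_mul z w : complex.Re (z * w) =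
  complex.Re z * complex.Re w - complex.Im z * complex.Im w.
Proof. by case: z w => [a b] [c d]. Qed.

Lemma Im_mul z w : complex.Im (z * w) =
  complex.Re z * complex.Im w + complex.Im z * complex.Re w.
Proof. by case: z w => [a b] [c d]. Qed.

Lemma Re_add z w : complex.Re (z + w) = complex.Re z + complex.Re w.
Proof. by case: z w => [a b] [c d]. Qed.

Lemma Im_add z w : complex.Im (z + w) = complex.Im z + complex.Im w.
Proof. by case: z w => [a b] [c d]. Qed.

Lemma Re_opp z : complex.Re (- z) = - complex.Re z.
Proof. by case: z => [a b]. Qed.

Lemma Im_opp z : complex.Im (- z) = - complex.Im z.
Proof. by case: z => [a b]. Qed.

Lemma Re_conjc z : complex.Re (conjc z) = complex.Re z.
Proof. by case: z => [a b]. Qed.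

Lemma Im_conjc z : complex.Im (conjc z) = - complex.Im z.
Proof. by case: z => [a b]. Qed.

Lemma Re_cmod z : `|complex.Re z| <= cmod z.
Proof.
by rewrite -sqrtr_sqr ler_sqrt ?addr_ge0 ?sqr_ge0// lerDl sqr_ge0.
Qed.

Lemma Im_cmod z : `|complex.Im z| <= cmod z.
Proof.
by rewrite -sqrtr_sqr ler_sqrt ?addr_ge0 ?sqr_ge0// lerDr sqr_ge0.
Qed.

Lemma cmod_ReIm z : cmod z <= `|complex.Re z| + `|complex.Im z|.
Proof.
rewrite -(ler_pXn2r (_ : 0 < 2)%N) ?nnegrE ?cmod_ge0 ?addr_ge0//.
rewrite cmod_sqr sqrrD !real_normK ?num_real// -addrA [X in _ <= _ + X]addrC.
by rewrite addrA lerDl mulrn_wge0// mulr_ge0.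
Qed.

Lemma complex_ext z w :
  complex.Re z = complex.Re w -> complex.Im z = complex.Im w -> z = w.
Proof. by case: z w => [a b] [c d] /= -> ->. Qed.

Lemma cmodB z w : cmod (z - w) <= cmod z + cmod w.
Proof. by rewrite -[cmod w]cmodN cmodD. Qed.

Lemma cmodBC z w : cmod (z - w) = cmod (w - z).
Proof. by rewrite -cmodN opprB. Qed.

Lemma cmod1 : cmod (1 : C) = 1.
Proof. by rewrite cmodE Normc.normc1. Qed.

End ComplexModulus.

(** * Real integrals over the parameter interval, with almost-everywhere hypotheses *)

Section RealIntegrals.
Variable R : realType.
Local Notation mu := (@lebesgue_measure R).
Local Notation I := (@I01 R).
Implicit Types f g k : R -> R.

Lemma measurable_I01 : measurable I. Proof. exact: measurable_itv. Qed.
Hint Resolve measurable_I01 : core.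

Lemma measurable_I01' : measurable (I : set (measurableTypeR R)).
Proof. exact: measurable_itv. Qed.
Hint Resolve measurable_I01' : core.

Lemma measure_I01 : mu I = 1%E.
Proof. by rewrite lebesgue_measure_itv /= lte_fin ltr01 oppr0 adde0. Qed.

Definition intble (g : R -> R) : Prop := mu.-integrable I (EFin \o g).

Definition Ig (g : R -> R) : R := \int[mu]_(t in I) g t.

Lemma intble_meas g : intble g -> measurable_fun I g.
Proof. by move=> /measurable_int /measurable_EFinP. Qed.

Lemma measurable_EFin g : measurable_fun I g ->
  measurable_fun (I : set (measurableTypeR R)) (EFin \o g).
Proof. by move=> mg; apply/measurable_EFinP; exact: mg. Qed.

Lemma intble_norm f : intble f -> intble (fun t => `|f t|).
Proof. by move=> hf; have := integrable_norm hf. Qed.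

Lemma intbleD f g : intble f -> intble g -> intble (fun t => f t + g t).
Proof. by move=> hf hg; have := integrableD measurable_I01' hf hg. Qed.

Lemma intbleZ c f : intble f -> intble (fun t => c * f t).
Proof. by move=> hf; have := integrableZl measurable_I01' c hf. Qed.

Lemma intbleB f g : intble f -> intble g -> intble (fun t => f t - g t).
Proof. by move=> hf hg; have := integrableB measurable_I01' hf hg. Qed.

Lemma intble_cst c : intble (fun=> c).
Proof.
apply/integrableP; split; first exact: measurable_cst.
by rewrite /= integral_cst//= measure_I01 mule1 ltry.
Qed.

Lemma ae01_filter2 (P Q S : R -> Prop) :
  (forall t, P t -> Q t -> S t) -> ae01 P -> ae01 Q -> ae01 S.
Proof.
move=> h; apply: (filterS2 (F := almost_everywhere mu)) => t hP hQ It; exact: h (hP It) (hQ It).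
Qed.

Lemma ae01_filter (P Q : R -> Prop) :
  (forall t, P t -> Q t) -> ae01 P -> ae01 Q.
Proof. by move=> h; apply: (filterS (F := almost_everywhere mu)) => t hP It; exact: h (hP It). Qed.

Lemma ae01T (P : R -> Prop) : (forall t, P t) -> ae01 P.
Proof. by move=> h; apply: aeW => t _; exact: h. Qed.

Lemma ae01_filter3 (P Q T S : R -> Prop) :
  (forall t, P t -> Q t -> T t -> S t) -> ae01 P -> ae01 Q -> ae01 T -> ae01 S.
Proof.
move=> h; apply: (filterS3 (F := almost_everywhere mu)) => t hP hQ hT It; exact: h (hP It) (hQ It) (hT It).
Qed.

Lemma intble_le g k : measurable_fun I g -> intble k ->
  ae01 (fun t => `|g t| <= k t) -> intble g.
Proof.
move=> mg ik gk; apply/integrableP; split; first exact/measurable_EFinP.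
have /integrableP[mk] := ik.
apply: le_lt_trans; apply: ae_ge0_le_integral => //.
- apply: measurableT_comp => //; exact/measurable_EFinP.
- exact: measurableT_comp.
apply: ae01_filter gk => t h /=; rewrite lee_fin.
by apply: le_trans h _; exact: ler_norm.
Qed.

Lemma IgD f g : intble f -> intble g -> Ig (fun t => f t + g t) = Ig f + Ig g.
Proof. by move=> hf hg; rewrite /Ig RintegralD. Qed.

Lemma IgB f g : intble f -> intble g -> Ig (fun t => f t - g t) = Ig f - Ig g.
Proof. by move=> hf hg; rewrite /Ig RintegralB. Qed.

Lemma IgZ c f : intble f -> Ig (fun t => c * f t) = c * Ig f.
Proof. by move=> hf; rewrite /Ig RintegralZl. Qed.

Lemma Ig_cst c : Ig (fun=> c) = c.
Proof.
have := @Rintegral_cst _ _ R mu I measurable_I01'.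
move=> /(_ c); rewrite (_ : fine _ = 1) ?mulr1//.
exact: (congr1 fine measure_I01).
Qed.

Lemma Ig_ae f g : measurable_fun I f -> measurable_fun I g ->
  ae01 (fun t => f t = g t) -> Ig f = Ig g.
Proof.
move=> mf mg fg; congr fine; apply: ae_eq_integral => //; try exact/measurable_EFinP.
by apply: ae01_filter fg => t h /=; rewrite h.
Qed.

Lemma Ig_le f g : intble f -> intble g -> ae01 (fun t => f t <= g t) -> Ig f <= Ig g.
Proof.
move=> hf hg fg; pose k t := Num.max (f t) (g t).
have mk : measurable_fun I k by apply: measurable_maxr; exact: intble_meas.
have gk : ae01 (fun t => g t = k t).
  by apply: ae01_filter fg => t h; rewrite /k; apply/esym/max_idPr.
have ik : intble k.
  apply: (intble_le mk (intble_norm hg)).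
  by apply: ae01_filter gk => t <-.
rewrite (Ig_ae (intble_meas hg) mk gk).
by apply: le_Rintegral => // t _; rewrite /k le_max lexx.
Qed.

Lemma Ig_ge0 f : (forall t, 0 <= f t) -> 0 <= Ig f.
Proof. by move=> h; apply: Rintegral_ge0 => t _; exact: h. Qed.

Lemma EFin_Ig f : intble f -> (\int[mu]_(t in I) (f t)%:E)%E = (Ig f)%:E.
Proof. by move=> hf; rewrite fineK//; exact: integrable_fin_num. Qed.

Lemma Ig_eq0 f : intble f -> (forall t, 0 <= f t) -> Ig f = 0 -> ae01 (fun t => f t = 0).
Proof.
move=> hf f0 If; have h : (\int[mu]_(t in I) `|(f t)%:E|)%E = 0%E.
  under eq_integral => t _ do rewrite gee0_abs ?lee_fin//.
  by rewrite EFin_Ig// If.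
have mf := measurable_EFin (intble_meas hf).
move/(ae_eq_integral_abs mu measurable_I01' mf): h.
by apply: (filterS (F := almost_everywhere mu)) => t h It; have [] := h It.
Qed.

Lemma Ig_abs f : intble f -> `|Ig f| <= Ig (fun t => `|f t|).
Proof. by move=> hf; exact: le_normr_Rintegral. Qed.

(** Zeros of [g] are harmless: the inverse and the power with exponent [- 1] both send 0 to 0. *)
Lemma measurable_inv g : measurable_fun I g -> (forall t, 0 <= g t) ->
  measurable_fun I (fun t => (g t)^-1).
Proof.
move=> mg g0; rewrite (_ : (fun t => _) = (@powR R ^~ (- 1)) \o g).
  by apply: measurableT_comp => //; exact: measurable_powR.
by apply/funext => t /=; rewrite powR_inv1.
Qed.

Lemma measurable_sqrt g : measurable_fun I g ->
  measurable_fun I (fun t => Num.sqrt (g t)).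
Proof.
move=> mg; apply: (measurableT_comp (f := @Num.sqrt R)) => //.
apply: continuous_measurable_fun; exact: sqrt_continuous.
Qed.

Lemma Ig_dominated (f_ : nat -> R -> R) f k :
  (forall n, measurable_fun I (f_ n)) -> measurable_fun I f -> intble k ->
  ae01 (fun t => f_ ^~ t @ \oo --> f t) ->
  ae01 (fun t => forall n, `|f_ n t| <= k t) ->
  Ig (fun t => `|f_ n t - f t|) @[n --> \oo] --> 0.
Proof.
move=> mf_ mf ik cf fk.
have H := @dominated_convergence _ _ R mu I measurable_I01'
  (fun n => EFin \o f_ n) (EFin \o f) (EFin \o k).
have [//|//|//|//|//|/integrableP[_ _] h _] := H.
- by move=> n; exact: measurable_EFin.
- exact: measurable_EFin.
- apply: ae01_filter cf => t h; apply: cvg_EFin; last exact: h.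
  by near=> n.
- by apply: (filterS (F := almost_everywhere mu)) fk => t h n It; rewrite /= lee_fin; exact: h.
by move/fine_cvgP : h => [].
Unshelve. all: by end_near. Qed.

End RealIntegrals.
#[global] Hint Resolve measurable_I01 measurable_I01' : core.

(** * Complex integrals, Fourier coefficients and the linear structure of [H1] *)

Section ComplexIntegrals.
Variable R : realType.
Local Notation C := R[i].
Local Notation I := (@I01 R).
Implicit Types (f g : R -> C) (k : R -> R) (c : C).

Lemma cmeasD f g : cmeasurable f -> cmeasurable g -> cmeasurable (fun t => f t + g t).
Proof.
move=> [rf jf] [rg jg]; split.
  by under eq_fun do rewrite Re_add; exact: measurable_funD.
by under eq_fun do rewrite Im_add; exact: measurable_funD.
Qed.

Lemma cmeasN f : cmeasurable f -> cmeasurable (fun t => - f t).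
Proof.
move=> [rf jf]; split.
  by under eq_fun do rewrite Re_opp; exact: measurable_funN.
by under eq_fun do rewrite Im_opp; exact: measurable_funN.
Qed.

Lemma cmeasB f g : cmeasurable f -> cmeasurable g -> cmeasurable (fun t => f t - g t).
Proof. by move=> hf hg; apply: cmeasD => //; exact: cmeasN. Qed.

Lemma cmeasM f g : cmeasurable f -> cmeasurable g -> cmeasurable (fun t => f t * g t).
Proof.
move=> [rf jf] [rg jg]; split.
  by under eq_fun do rewrite Re_mul; apply: measurable_funB; exact: measurable_funM.
by under eq_fun do rewrite Im_mul; apply: measurable_funD; exact: measurable_funM.
Qed.

Lemma cmeas_conj f : cmeasurable f -> cmeasurable (fun t => conjc (f t)).
Proof.
move=> [rf jf]; split.
  by under eq_fun do rewrite Re_conjc.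
by under eq_fun do rewrite Im_conjc; exact: measurable_funN.
Qed.

Lemma cmeas_cst c : cmeasurable (fun _ : R => c).
Proof. by split; exact: measurable_cst. Qed.

Lemma cmeas_real k : measurable_fun I k -> cmeasurable (fun t => (k t)%:C%C).
Proof. by move=> mk; split => //=; exact: measurable_cst. Qed.

Lemma cmeas_cmod f : cmeasurable f -> measurable_fun I (fun t => cmod (f t)).
Proof.
move=> [rf jf]; apply: measurable_sqrt; apply: measurable_funD;
  exact: measurable_funX.
Qed.

(** True at 0 as well, by the convention that 0 is its own inverse; inverses are thus measurable
    without excluding zeros. *)
Lemma invc_conj (z : C) : z^-1 = (((cmod z ^+ 2)^-1)%:C)%C * conjc z.
Proof.
rewrite cmod_sqr; case: z => a b; apply: complex_ext => /=; first by ring.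
by ring.
Qed.

Lemma cmeasV f : cmeasurable f -> cmeasurable (fun t => (f t)^-1).
Proof.
move=> mf; under eq_fun do rewrite invc_conj.
apply: cmeasM; last exact: cmeas_conj.
apply: cmeas_real; apply: measurable_inv => [|t]; last exact: sqr_ge0.
by apply: measurable_funX; exact: cmeas_cmod.
Qed.

Lemma cmeas_zpow (n : int) : cmeasurable (@zpow R n).
Proof.
have h : measurable_fun I (fun t : R => 2 * pi * n%:~R * t).
  by apply: measurable_funM => //; exact: measurable_cst.
split => /=.
  apply: (measurableT_comp (f := @cos R)) => //.
  exact: (continuous_measurable_fun (@continuous_cos R)).
apply: (measurableT_comp (f := @sin R)) => //.
exact: (continuous_measurable_fun (@continuous_sin R)).
Qed.

Lemma L1P f : L1 f <-> cmeasurable f /\ intble (fun t => cmod (f t)).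
Proof.
split=> -[mf hf]; split => //.
  apply/integrableP; split; first exact: measurable_EFin (cmeas_cmod mf).
  under eq_integral => t _ do rewrite /= ger0_norm ?cmod_ge0//.
  exact: hf.
by rewrite EFin_Ig// ltry.
Qed.

Lemma L1_meas f : L1 f -> cmeasurable f. Proof. by case. Qed.

Lemma L1_cmod f : L1 f -> intble (fun t => cmod (f t)).
Proof. by move=> /L1P[]. Qed.

Lemma L1_le f k : cmeasurable f -> intble k ->
  ae01 (fun t => cmod (f t) <= k t) -> L1 f.
Proof.
move=> mf ik fk; apply/L1P; split => //.
apply: (intble_le _ ik); first exact: cmeas_cmod.
by apply: ae01_filter fk => t; rewrite ger0_norm// cmod_ge0.
Qed.

Lemma L1_Re f : L1 f -> intble (fun t => complex.Re (f t)).
Proof.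
move=> h; apply: (intble_le _ (L1_cmod h)); first by case: h => -[].
by apply: ae01T => t; exact: Re_cmod.
Qed.

Lemma L1_Im f : L1 f -> intble (fun t => complex.Im (f t)).
Proof.
move=> h; apply: (intble_le _ (L1_cmod h)); first by case: h => -[].
by apply: ae01T => t; exact: Im_cmod.
Qed.

Lemma L1_ReIm f : intble (fun t => complex.Re (f t)) ->
  intble (fun t => complex.Im (f t)) -> L1 f.
Proof.
move=> hr hi; apply: (L1_le _ (intbleD (intble_norm hr) (intble_norm hi))).
  by split; exact: intble_meas.
by apply: ae01T => t; exact: cmod_ReIm.
Qed.

Lemma L1D f g : L1 f -> L1 g -> L1 (fun t => f t + g t).
Proof.
move=> hf hg; apply: (L1_le _ (intbleD (L1_cmod hf) (L1_cmod hg))).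
  by apply: cmeasD; exact: L1_meas.
by apply: ae01T => t; exact: cmodD.
Qed.

Lemma L1M f g (M : R) : cmeasurable g -> ae01 (fun t => cmod (g t) <= M) ->
  L1 f -> L1 (fun t => g t * f t).
Proof.
move=> mg gM hf; apply: (L1_le _ (intbleZ M (L1_cmod hf))).
  by apply: cmeasM => //; exact: L1_meas.
by apply: ae01_filter gM => t h; rewrite cmodM ler_wpM2r// cmod_ge0.
Qed.

Lemma L1Z c f : L1 f -> L1 (fun t => c * f t).
Proof.
by apply: (L1M (M := cmod c)); [exact: cmeas_cst|exact: ae01T].
Qed.

Lemma L1N f : L1 f -> L1 (fun t => - f t).
Proof. by move=> /(L1Z (-1)); under eq_fun do rewrite mulN1r. Qed.

Lemma L1B f g : L1 f -> L1 g -> L1 (fun t => f t - g t).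
Proof. by move=> hf hg; apply: L1D => //; exact: L1N. Qed.

Lemma L1_conj f : L1 f -> L1 (fun t => conjc (f t)).
Proof.
move=> hf; apply: (L1_le _ (L1_cmod hf)); first exact/cmeas_conj/L1_meas.
by apply: ae01T => t; rewrite cmod_conj.
Qed.

Lemma L1_real k : intble k -> L1 (fun t => (k t)%:C%C).
Proof. by move=> ik; apply: L1_ReIm => //=; exact: intble_cst. Qed.

Lemma L1_cst c : L1 (fun _ : R => c).
Proof. by apply: L1_ReIm; exact: intble_cst. Qed.

Lemma L1_ae f g : L1 f -> cmeasurable g -> ae01 (fun t => f t = g t) -> L1 g.
Proof.
move=> hf mg fg; apply: (L1_le mg (L1_cmod hf)).
by apply: ae01_filter fg => t ->.
Qed.

Lemma L1_bounded f (M : R) : cmeasurable f -> ae01 (fun t => cmod (f t) <= M) -> L1 f.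
Proof. by move=> mf; exact: (L1_le mf (intble_cst M)). Qed.

Definition cint f : C :=
  Complex (Ig (fun t => complex.Re (f t))) (Ig (fun t => complex.Im (f t))).

Lemma cintD f g : L1 f -> L1 g -> cint (fun t => f t + g t) = cint f + cint g.
Proof.
move=> hf hg; apply: complex_ext; rewrite ?Re_add ?Im_add /= -IgD;
  by [congr Ig; apply/funext => t; rewrite ?Re_add ?Im_add | exact: L1_Re | exact: L1_Im].
Qed.

Lemma cintZ c f : L1 f -> cint (fun t => c * f t) = c * cint f.
Proof.
move=> hf; have hr := L1_Re hf; have hi := L1_Im hf.
apply: complex_ext; rewrite ?Re_mul ?Im_mul /= -!IgZ // -?IgB -?IgD;
  try exact: intbleZ.
  by congr Ig; apply/funext => t; rewrite Re_mul.
by congr Ig; apply/funext => t; rewrite Im_mul.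
Qed.

Lemma cintN f : L1 f -> cint (fun t => - f t) = - cint f.
Proof.
by move=> hf; rewrite -mulN1r -cintZ//; congr cint; apply/funext => t; rewrite mulN1r.
Qed.

Lemma cintB f g : L1 f -> L1 g -> cint (fun t => f t - g t) = cint f - cint g.
Proof. by move=> hf hg; rewrite cintD ?cintN//; exact: L1N. Qed.

Lemma cint_conj f : L1 f -> cint (fun t => conjc (f t)) = conjc (cint f).
Proof.
move=> hf; apply: complex_ext => /=.
  by congr Ig; apply/funext => t; rewrite Re_conjc.
rewrite -mulN1r -IgZ; last exact: L1_Im.
by congr Ig; apply/funext => t; rewrite Im_conjc mulN1r.
Qed.

Lemma cint_ae f g : cmeasurable f -> cmeasurable g -> ae01 (fun t => f t = g t) ->
  cint f = cint g.
Proof.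
move=> [rf jf] [rg jg] fg; apply: complex_ext => /=; apply: Ig_ae => //;
  by apply: ae01_filter fg => t ->.
Qed.

Lemma cint_real k : cint (fun t => (k t)%:C%C) = (Ig k)%:C%C.
Proof. by apply: complex_ext => //=; exact: Ig_cst. Qed.

Lemma cint_cst c : cint (fun=> c) = c.
Proof. by apply: complex_ext => /=; exact: Ig_cst. Qed.

(** Real and imaginary parts are bounded separately, whence the crude factor 2; only continuity of
    the integral in the [L1] norm is wanted. *)
Lemma cmod_cint f : L1 f -> cmod (cint f) <= 2 * norm1 f.
Proof.
move=> hf; apply: le_trans (cmod_ReIm _) _ => /=.
rewrite mulr_natl mulr2n; apply: lerD.
  apply: le_trans (Ig_abs (L1_Re hf)) _; apply: Ig_le.
  - exact/intble_norm/L1_Re.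
  - exact: L1_cmod.
  by apply: ae01T => t; exact: Re_cmod.
apply: le_trans (Ig_abs (L1_Im hf)) _; apply: Ig_le.
- exact/intble_norm/L1_Im.
- exact: L1_cmod.
by apply: ae01T => t; exact: Im_cmod.
Qed.

Lemma norm1_ge0 f : 0 <= norm1 f.
Proof. by apply: Ig_ge0 => t; exact: cmod_ge0. Qed.

Lemma norm1_ae f g : cmeasurable f -> cmeasurable g -> ae01 (fun t => f t = g t) ->
  norm1 f = norm1 g.
Proof.
move=> mf mg fg; apply: Ig_ae; try exact: cmeas_cmod.
by apply: ae01_filter fg => t ->.
Qed.

Lemma norm1_eq0 f : L1 f -> norm1 f = 0 -> ae01 (fun t => f t = 0).
Proof.
move=> hf /(Ig_eq0 (L1_cmod hf)) h.
by apply: ae01_filter (h _) => [t|t]; [exact: cmod_eq0 | exact: cmod_ge0].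
Qed.

Lemma zpowD (m n : int) (t : R) : zpow (m + n) t = zpow m t * zpow n t.
Proof.
rewrite /zpow intrD mulrDr mulrDl cosD sinD.
by apply: complex_ext => /=; rewrite // [X in X + _]mulrC [X in _ + X]mulrC addrC;
  congr (_ + _); rewrite mulrC.
Qed.

Lemma zpow0 (t : R) : zpow 0 t = 1.
Proof. by rewrite /zpow mulr0z mulr0 mul0r cos0 sin0. Qed.

Lemma conj_zpow (n : int) (t : R) : conjc (zpow n t) = zpow (- n) t.
Proof. by rewrite /zpow /= rmorphN /= mulrN mulNr cosN sinN. Qed.

Lemma cmod_zpow (n : int) (t : R) : cmod (zpow n t) = 1.
Proof. by rewrite /cmod /= cos2Dsin2 sqrtr1. Qed.

Lemma fourierE f (k : int) : fourier f k = cint (fun t => zpow (- k) t * f t).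
Proof. by rewrite /fourier; apply: complex_ext => /=; congr Ig; apply/funext => t;
  rewrite -conj_zpow. Qed.

Lemma L1_zpow f (n : int) : L1 f -> L1 (fun t => zpow n t * f t).
Proof.
move=> hf; apply: (@L1M _ _ 1) => //; first exact: cmeas_zpow.
by apply: ae01T => t; rewrite cmod_zpow.
Qed.

Lemma L1_zpow1 (n : int) : L1 (@zpow R n).
Proof.
apply: (@L1_bounded _ 1); first exact: cmeas_zpow.
by apply: ae01T => t; rewrite cmod_zpow.
Qed.

(** The negative indices are the [- n.+1], and conjugating [zpow] flips the sign of its index; no
    conjugate is left in this working form. *)
Lemma H1P f : H1 f <-> L1 f /\ forall n : nat, cint (fun t => zpow n.+1 t * f t) = 0.
Proof.
split=> -[hf h]; split => //.
  by move=> n; have /h : (- (n.+1 : int)) < 0 by []; rewrite fourierE opprK.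
by case=> // n _; rewrite fourierE NegzE opprK.
Qed.

Lemma H1_L1 f : H1 f -> L1 f. Proof. by case. Qed.

Lemma H1_meas f : H1 f -> cmeasurable f. Proof. by case => -[]. Qed.

(** The hypothesis is supplied later by [cint_zpow], through the fundamental theorem of calculus. *)
Lemma H1_cst c : (forall n : nat, cint (@zpow R n.+1) = 0) -> H1 (fun _ : R => c).
Proof.
move=> h; apply/H1P; split => [|n]; first exact: L1_cst.
rewrite (_ : (fun t => _) = (fun t => c * zpow n.+1 t)).
  by rewrite cintZ ?h ?mulr0//; exact: L1_zpow1.
by apply/funext => t; rewrite mulrC.
Qed.

Lemma H1D f g : H1 f -> H1 g -> H1 (fun t => f t + g t).
Proof.
move=> /H1P[hf cf] /H1P[hg cg]; apply/H1P; split => [|n]; first exact: L1D.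
rewrite (_ : (fun t => _) = (fun t => zpow n.+1 t * f t + zpow n.+1 t * g t)).
  by rewrite cintD ?cf ?cg ?addr0//; exact: L1_zpow.
by apply/funext => t; rewrite mulrDr.
Qed.

Lemma H1Z c f : H1 f -> H1 (fun t => c * f t).
Proof.
move=> /H1P[hf cf]; apply/H1P; split => [|n]; first exact: L1Z.
rewrite (_ : (fun t => _) = (fun t => c * (zpow n.+1 t * f t))).
  by rewrite cintZ ?cf ?mulr0//; exact: L1_zpow.
by apply/funext => t; rewrite mulrCA.
Qed.

Lemma H1N f : H1 f -> H1 (fun t => - f t).
Proof. by move=> /(H1Z (-1)); under eq_fun do rewrite mulN1r. Qed.

Lemma H1B f g : H1 f -> H1 g -> H1 (fun t => f t - g t).
Proof. by move=> hf hg; apply: H1D => //; exact: H1N. Qed.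

Lemma H1_ae f g : H1 f -> cmeasurable g -> ae01 (fun t => f t = g t) -> H1 g.
Proof.
move=> /H1P[hf cf] mg fg; apply/H1P; split => [|n]; first exact: L1_ae fg.
rewrite -(cf n); apply: cint_ae.
- by apply: cmeasM => //; exact: cmeas_zpow.
- by apply: cmeasM; [exact: cmeas_zpow | exact: L1_meas].
by apply: ae01_filter fg => t ->.
Qed.

Lemma H1_zpow f (n : nat) : H1 f -> H1 (fun t => zpow n t * f t).
Proof.
move=> /H1P[hf cf]; apply/H1P; split => [|m]; first exact: L1_zpow.
rewrite -(cf (m + n)%N); congr cint; apply/funext => t.
by rewrite mulrA -zpowD.
Qed.

(** Each Fourier coefficient is continuous for the [L1] norm. Most approximation arguments below end
    with this lemma. *)
Lemma H1_closed f : L1 f ->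
  (forall e : R, 0 < e -> exists2 g, H1 g & norm1 (fun t => f t - g t) <= e) -> H1 f.
Proof.
move=> hf h; apply/H1P; split => // n; apply: cmod_eq0; apply/eqP.
rewrite eq_le cmod_ge0 andbT; apply/ler_addgt0Pl => e e0; rewrite addr0.
have [g hg ng] := h (e / 2) (divr_gt0 e0 (ltr0Sn _ 1)).
have /H1P[hg1 cg] := hg.
rewrite -[X in cmod X]subr0 -(cg n) -cintB; try exact: L1_zpow.
apply: le_trans (cmod_cint _) _.
  by apply: L1B; exact: L1_zpow.
rewrite -ler_pdivlMl// mulrC; apply: le_trans ng; apply: Ig_le.
- by apply: L1_cmod; apply: L1B; exact: L1_zpow.
- by apply: L1_cmod; apply: L1B.
by apply: ae01T => t; rewrite -mulrBr cmodM cmod_zpow mul1r.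
Qed.

End ComplexIntegrals.

(** * Uniqueness of Fourier coefficients of integrable functions *)

Section FourierUniqueness.
Variable R : realType.
Local Notation C := R[i].
Local Notation mu := (@lebesgue_measure R).
Local Notation I := (@I01 R).
Implicit Types (f g : R -> C).

Lemma cvg_lower_bound (u : nat -> R) (a l : R) : u @ \oo --> l ->
  (forall n, a <= u n) -> a <= l.
Proof.
move=> c h; rewrite -(cvg_lim (@Rhausdorff R) c).
by apply: limr_ge; [exact: cvgP c|exact: nearW].
Qed.

Lemma Ig_FTC (h F : R -> R) : continuous h -> (forall t : R, is_derive t 1 F (h t)) ->
  Ig h = F 1 - F 0.
Proof.
move=> ch dF; have cF : continuous F.
  move=> t; apply: differentiable_continuous; apply/derivable1_diffP.
  exact: ex_derive.
have H := @continuous_FTC2 R h F 0 1 ltr01 (continuous_subspaceT ch).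
rewrite /Ig /Rintegral H//.
  split; first by move=> t _; exact: ex_derive.
  - exact/cvg_at_right_filter/cF.
  - exact/cvg_at_left_filter/cF.
by move=> t _; rewrite derive1E derive_val.
Qed.

Lemma zpow1_nat (n : nat) : zpow n 1 = 1 :> C.
Proof.
elim: n => [|n ih]; first exact: zpow0.
rewrite -addn1 PoszD zpowD ih mul1r /zpow mulr1z !mulr1 mulrC mulr_natr.
by rewrite cos2pi sin2pi.
Qed.

Lemma cint_zpow (n : nat) : cint (@zpow R n.+1) = 0.
Proof.
pose a : R := 2 * pi * (n.+1 : int)%:~R.
have a0 : a != 0.
  by rewrite !mulf_neq0 ?pnatr_eq0 ?intr_eq0// gt_eqF// pi_gt0.
have da (t : R) : is_derive t 1 (fun t : R => a * t) a.
  by have := @is_deriveM R R (cst a) id t 1 0 1 _ _; rewrite /= scaler0 addr0; rewrite /GRing.scale /= mulr1; apply.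
have ca : continuous (fun t : R => a * t).
  by move=> t; apply: cvgM; [exact: cvg_cst|exact: cvg_id].
have := zpow1_nat n.+1; rewrite /zpow -/a mulr1 => -[c1 s1].
rewrite /cint /zpow /= -/a.
have -> : Ig (fun t : R => cos (a * t)) = a^-1 * sin (a * 1) - a^-1 * sin (a * 0).
  apply: (@Ig_FTC _ (fun t => a^-1 * sin (a * t))) => t.
    by apply: (@continuous_comp _ _ _ (fun t => a * t)); [exact: ca|exact: continuous_cos].
  have d1 := @is_derive1_comp R (@sin R) (fun t => a * t) t _ _ (is_derive_sin _) (da t).
  have d2 := @is_deriveM R R (cst a^-1) (@sin R \o (fun t => a * t)) t 1 0 _
    (is_derive_cst _ _ _) d1.
  apply: (is_derive_eq d2); rewrite scaler0 addr0 /GRing.scale /=.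
  by rewrite mulrCA mulVf// mulr1.
have -> : Ig (fun t : R => sin (a * t)) = a^-1 * - cos (a * 1) - a^-1 * - cos (a * 0).
  apply: (@Ig_FTC _ (fun t => a^-1 * - cos (a * t))) => t.
    by apply: (@continuous_comp _ _ _ (fun t => a * t)); [exact: ca|exact: continuous_sin].
  have d1 := @is_derive1_comp R (@cos R) (fun t => a * t) t _ _ (is_derive_cos _) (da t).
  have d2 := @is_deriveM R R (cst a^-1) (- (@cos R \o (fun t => a * t))) t 1 0 _
    (is_derive_cst _ _ _) (is_deriveN d1).
  apply: (is_derive_eq d2); rewrite scaler0 addr0 /GRing.scale /=.
  by rewrite mulNr opprK mulrCA mulVf// mulr1.
by rewrite mulr1 mulr0 c1 s1 cos0 sin0 !subrr.
Qed.

(** The functions that must be shown null: those orthogonal to every trigonometric polynomial. *)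
Definition annih f := L1 f /\ forall k : int, cint (fun t => zpow k t * f t) = 0.

(** An algebra containing the constants and all [zpow n]. Working with what multiplication by a
    trigonometric polynomial does to [annih] spares any explicit description of such polynomials. *)
Definition mult f := [/\ cmeasurable f, exists M : R, forall t, cmod (f t) <= M
  & forall g, annih g -> annih (fun t => f t * g t)].

Lemma mult_cst (c : C) : mult (fun=> c).
Proof.
split; [exact: cmeas_cst|by exists (cmod c)|move=> g [hg cg]].
split=> [|k]; first exact: L1Z.
under eq_fun do rewrite mulrCA.
by rewrite cintZ ?cg ?mulr0//; exact: L1_zpow.
Qed.

Lemma mult_zpow (n : int) : mult (@zpow R n).
Proof.
split; [exact: cmeas_zpow|by exists 1 => t; rewrite cmod_zpow|move=> g [hg cg]].
split=> [|k]; first exact: L1_zpow.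
by under eq_fun do rewrite mulrA -zpowD.
Qed.

Lemma multD f g : mult f -> mult g -> mult (fun t => f t + g t).
Proof.
move=> hf hg; have [mf [M fM] af] := hf; have [mg [N gN] ag] := hg.
split; first exact: cmeasD.
  by exists (M + N) => t; apply: le_trans (cmodD _ _) _; apply: lerD.
move=> h hh; have [h1 c1] := af _ hh; have [h2 c2] := ag _ hh.
split=> [|k]; first by under eq_fun do rewrite mulrDl; exact: L1D.
under eq_fun do rewrite mulrDl mulrDr.
by rewrite cintD ?c1 ?c2 ?addr0//; exact: L1_zpow.
Qed.

Lemma multM f g : mult f -> mult g -> mult (fun t => f t * g t).
Proof.
move=> hf hg; have [mf [M fM] af] := hf; have [mg [N gN] ag] := hg.
split; first exact: cmeasM.
  by exists (M * N) => t; rewrite cmodM; apply: ler_pM => //; exact: cmod_ge0.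
by move=> h /ag /af; under eq_fun do rewrite mulrA.
Qed.

Lemma multX f n : mult f -> mult (fun t => f t ^+ n).
Proof.
move=> hf; elim: n => [|n ih]; first exact: (mult_cst 1).
by under eq_fun do rewrite exprS; exact: multM.
Qed.

(* The Stone-Weierstrass step polynomials: [(1 - y^n)^(2^n)] tends to the
   indicator of [y < 1/2] boundedly on [0, 1]. *)
Definition step_poly n (y : R) : R := (1 - y ^+ n) ^+ (2 ^ n).

Lemma bernoulli_ge (a : R) m : 0 <= a <= 1 -> 1 - m%:R * a <= (1 - a) ^+ m.
Proof.
move=> /andP[a0 a1]; elim: m => [|m ih]; first by rewrite mul0r subr0 expr0.
rewrite exprS; apply: (@le_trans _ _ ((1 - a) * (1 - m%:R * a))).
  rewrite -natr1; have : 0 <= m%:R * a * a by rewrite !mulr_ge0.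
  by move=> h; lra.
by apply: ler_wpM2l ih; lra.
Qed.

(** [m a <= (1 + a)^m] by Bernoulli, and [(1 + a)^m (1 - a)^m = (1 - a^2)^m <= 1]. *)
Lemma bernoulli_le (a : R) m : 0 <= a <= 1 -> (m%:R * a) * (1 - a) ^+ m <= 1.
Proof.
move=> /andP[a0 a1]; have h0 : 0 <= (1 - a) ^+ m by apply: exprn_ge0; lra.
have h1 : m%:R * a <= (1 + a) ^+ m.
  have h2 : 1 + m%:R * a <= (1 + a) ^+ m.
    elim: m {h0} => [|m ih]; first by rewrite mul0r addr0 expr0.
    rewrite exprS; apply: (@le_trans _ _ ((1 + a) * (1 + m%:R * a))).
      rewrite -natr1; have : 0 <= m%:R * a * a by rewrite !mulr_ge0.
      by move=> h; lra.
    by apply: ler_wpM2l ih; lra.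
  by lra.
apply: (le_trans (ler_wpM2r h0 h1)); rewrite -exprMn.
by apply: exprn_ile1; nra.
Qed.

Lemma step_poly_le1 n (y : R) : 0 <= y <= 1 -> `|step_poly n y| <= 1.
Proof.
move=> /andP[y0 y1]; have h0 := exprn_ge0 n y0; have h1 := exprn_ile1 n y0 y1.
rewrite ger0_norm; first by apply: exprn_ile1; lra.
by apply: exprn_ge0; lra.
Qed.

(** Bernoulli bounds the polynomial below by [1 - 2^n y^n = 1 - (2 y)^n]; this is the source of the
    threshold [1/2]. *)
Lemma step_poly_cvg1 (y : R) : 0 <= y < 2^-1 -> step_poly n y @[n --> \oo] --> (1 : R).
Proof.
move=> /andP[y0 y2]; have y1 : y <= 1 by lra.
have c : 1 - (2 * y) ^+ n @[n --> \oo] --> (1 : R).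
  rewrite -[X in _ --> X]subr0; apply: cvgB; first exact: cvg_cst.
  by apply: cvg_expr; rewrite ger0_norm; lra.
apply: (squeeze_cvgr _ c (cvg_cst (1 : R))); near=> n.
have h0 := exprn_ge0 n y0; have h1 := exprn_ile1 n y0 y1.
apply/andP; split; last by apply: exprn_ile1; lra.
rewrite exprMn -natrX; apply: bernoulli_ge; exact/andP.
Unshelve. all: by end_near. Qed.

Lemma step_poly_cvg0 (y : R) : 2^-1 < y <= 1 -> step_poly n y @[n --> \oo] --> (0 : R).
Proof.
move=> /andP[y2 y1]; have y0 : 0 < y by lra.
have c : ((2 * y)^-1) ^+ n @[n --> \oo] --> (0 : R).
  apply: cvg_expr; rewrite ger0_norm ?invr_ge0; last by lra.
  by rewrite invf_lt1; lra.
apply: (squeeze_cvgr _ (cvg_cst 0) c); near=> n.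
have h0 := exprn_gt0 n y0; have h1 := exprn_ile1 n (ltW y0) y1.
apply/andP; split; first by apply: exprn_ge0; lra.
rewrite exprVn -[leRHS]mul1r ler_pdivlMr; last by apply: exprn_gt0; lra.
rewrite mulrC exprMn -natrX; apply: bernoulli_le; apply/andP; split => //; exact: ltW.
Unshelve. all: by end_near. Qed.

(** A trigonometric polynomial of degree one with values in [[0, 1]]. By the product form [arcE] it
    is below [1/2] for [0 < t < x] and above [1/2] for [x < t < 1], so the step polynomials applied
    to it approach the indicator of an arc. *)
Definition arc (x t : R) : R := 2^-1 + (cos (pi * x) - cos (2 * pi * t - pi * x)) / 4.

Lemma arcE (x t : R) : arc x t = 2^-1 + sin (pi * t) * sin (pi * (t - x)) / 2.
Proof.
rewrite /arc (_ : pi * x = pi * t - pi * (t - x)); last by ring.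
rewrite (_ : 2 * pi * t - _ = pi * t + pi * (t - x)); last by ring.
by rewrite cosB cosD; field.
Qed.

Lemma arc01 (x t : R) : 0 <= arc x t <= 1.
Proof.
rewrite /arc; have := cos_geN1 (pi * x); have := cos_le1 (pi * x).
have := cos_geN1 (2 * pi * t - pi * x); have := cos_le1 (2 * pi * t - pi * x).
by move=> *; apply/andP; split; lra.
Qed.

Lemma mult_arc (x : R) : mult (fun t => (arc x t)%:C%C).
Proof.
pose c0 : C := (2^-1 + cos (pi * x) / 4)%:C%C.
(* [w] is [- exp (- i pi x) / 8]: the sum of [w z] and its conjugate is minus a quarter of
   [cos (2 pi t - pi x)]. *)
pose w : C := Complex (- cos (pi * x) / 8) (sin (pi * x) / 8).
rewrite (_ : (fun t => _) = (fun t => c0 + (w * zpow 1 t + conjc w * zpow (-1) t))).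
  apply: multD; first exact: mult_cst.
  apply: multD; apply: multM; by [exact: mult_cst|exact: mult_zpow].
have e1 t : 2 * pi * (1 : int)%:~R * t = 2 * pi * t :> R by rewrite mulr1z mulr1.
have eN t : 2 * pi * (-1 : int)%:~R * t = - (2 * pi * t) :> R.
  by rewrite mulrN1z mulrN1 mulNr.
apply/funext => t; apply: complex_ext; rewrite /zpow e1 eN ?Re_add ?Im_add ?Re_mul ?Im_mul /=.
  by rewrite cosN sinN /arc cosB; field.
by rewrite cosN sinN; field.
Qed.

Lemma mult_step_poly (n : nat) (x : R) : mult (fun t => (step_poly n (arc x t))%:C%C).
Proof.
rewrite (_ : (fun t => _) =
    (fun t => (1 + (-1) * ((arc x t)%:C%C) ^+ n) ^+ (2 ^ n))); last first.
  by apply/funext => t; rewrite /step_poly mulN1r rmorphXn rmorphB rmorphXn.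
apply: multX; apply: multD; first exact: mult_cst.
by apply: multM; [exact: mult_cst|apply: multX; exact: mult_arc].
Qed.

Lemma ae01_neq (a : R) : ae01 (fun t => t <> a).
Proof.
exists [set a]; split; first exact: measurable_set1.
  exact: lebesgue_measure_set1.
by move=> t /= /not_implyP[_] /contrapT.
Qed.

Lemma ae01_in (P : R -> Prop) : (forall t, 0 <= t <= 1 -> P t) -> ae01 P.
Proof. by move=> h; apply: aeW => t; rewrite /I01 /= in_itv /=; exact: h. Qed.

(** The points [0], [x] and [1], where [arc x] equals [1/2], are discarded as a null set. *)
Lemma step_poly_arc_cvg (x : R) : 0 < x < 1 ->
  ae01 (fun t => step_poly n (arc x t) @[n --> \oo] --> (if t <= x then 1 else 0 : R)).
Proof.
move=> /andP[x0 x1]; have pi0 := pi_gt0 R.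
have h : ae01 (fun t : R => 0 <= t <= 1) by exact: ae01_in.
have := ae01_filter2 (fun t a b => conj a b) (ae01_neq 0) (ae01_neq 1).
apply: (ae01_filter3 _ (ae01_neq x) h) => t /eqP tx /andP[t0 t1] [/eqP nt0 /eqP nt1].
have t0' : 0 < t by rewrite lt_neqAle eq_sym nt0.
have t1' : t < 1 by rewrite lt_neqAle nt1.
have st : 0 < sin (pi * t).
  by apply: sin_gt0_pi; rewrite mulr_gt0//= -[ltRHS]mulr1 ltr_pM2l.
have /andP[a0 a1] := arc01 x t; case: (ltP x t) => [xt|].
  have sx : 0 < sin (pi * (t - x)).
    apply: sin_gt0_pi; rewrite mulr_gt0 ?subr_gt0//= -[ltRHS]mulr1 ltr_pM2l//.
    by lra.
  by apply: step_poly_cvg0; rewrite a1 andbT arcE; nra.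
rewrite le_eqVlt (negbTE tx) /= => xt.
have sx : 0 < sin (pi * (x - t)).
  apply: sin_gt0_pi; rewrite mulr_gt0 ?subr_gt0//= -[ltRHS]mulr1 ltr_pM2l//.
  by lra.
apply: step_poly_cvg1; rewrite a0 /= arcE.
by rewrite -opprB mulrN sinN; nra.
Qed.

(** The coefficients of the conjugate of [f] are the conjugates of those of [f] at opposite indices,
    so the conjugate is annihilated too. *)
Lemma annih_Re f : annih f -> annih (fun t => (complex.Re (f t))%:C%C).
Proof.
move=> [hf cf]; split=> [|k]; first exact/L1_real/L1_Re.
under eq_fun do rewrite ReJ_add mulrA mulrDr [_ / _]mulrC.
have hc := L1_conj hf; rewrite cintZ; last by apply: L1D; exact: L1_zpow.
rewrite cintD; try exact: L1_zpow.
rewrite cf add0r; under eq_fun do rewrite -[zpow k _]conjcK conj_zpow -rmorphM.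
by rewrite cint_conj ?cf ?conjc0 ?mulr0//; exact: L1_zpow.
Qed.

(** For [0 < x < 1] the step polynomials in [arc x] are multipliers, so their integrals against the
    real part vanish, and dominated convergence passes to the indicator. The other [x] are included
    because the primitive used next starts at minus infinity. *)
Lemma annih_Re_itv f (x : R) : annih f ->
  Ig (fun t => complex.Re (f t) * (if t <= x then 1 else 0)) = 0.
Proof.
move=> hf; have [ha ca] := annih_Re hf; set g := fun t => complex.Re (f t).
have ig : intble g := L1_Re hf.1.
have mg := intble_meas ig.
have mx (y : R) : measurable_fun I (fun t : R => if t <= y then 1 else 0 : R).
  apply: measurable_fun_if; try exact: measurable_cst; first exact: measurable_I01.
  by apply: measurable_fun_ler => //; exact: measurable_cst.
have mgx (y : R) : measurable_fun I (fun t => g t * (if t <= y then 1 else 0)).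
  exact: measurable_funM.
have Ig0 : Ig g = 0.
  have := ca 0; under eq_fun do rewrite zpow0 mul1r.
  by rewrite cint_real => -[].
have [x0|x0] := leP x 0.
  rewrite -[RHS](Ig_cst 0); apply: Ig_ae; [exact: mgx|exact: measurable_cst|].
  have := @ae01_in (fun t => 0 <= t <= 1) (fun t h => h).
  apply: (ae01_filter2 _ (ae01_neq x)) => t /eqP tx /andP[t0 _].
  by rewrite leNgt lt_neqAle eq_sym tx (le_trans x0 t0) mulr0.
have [x1|x1] := leP 1 x.
  rewrite -[RHS]Ig0; apply: Ig_ae; [exact: mgx|exact: mg|].
  by apply: ae01_in => t /andP[_ t1]; rewrite (le_trans t1 x1) mulr1.
pose f_ n t := g t * step_poly n (arc x t).
have mf_ n : measurable_fun I (f_ n).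
  by apply: measurable_funM => //; case: (mult_step_poly n x) => -[].
have I0 n : Ig (f_ n) = 0.
  have [_ _ /(_ _ (annih_Re hf))[_ /(_ 0)]] := mult_step_poly n x.
  under eq_fun do rewrite zpow0 mul1r -rmorphM.
  rewrite cint_real => -[]; rewrite /f_ => <-.
  by congr Ig; apply/funext => t; rewrite mulrC.
have fg : ae01 (fun t => forall n, `|f_ n t| <= `|g t|).
  apply: ae01T => t n; rewrite normrM ler_piMr//.
  exact/step_poly_le1/arc01.
have if_ n : intble (f_ n).
  apply: (intble_le _ (intble_norm ig)) => //.
  by apply: ae01_filter fg => t; exact.
have igx : intble (fun t => g t * (if t <= x then 1 else 0)).
  apply: (intble_le _ (intble_norm ig)) => //.
  apply: ae01T => t; rewrite normrM ler_piMr//.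
  by case: ifP; rewrite ?normr1 ?normr0.
have cv : ae01 (fun t => f_ ^~ t @ \oo --> g t * (if t <= x then 1 else 0)).
  have := @step_poly_arc_cvg x; rewrite x0 x1 => /(_ isT).
  by apply: ae01_filter => t h; apply: cvgM; [exact: cvg_cst|exact: h].
have := Ig_dominated mf_ (mgx x) (intble_norm ig) cv fg.
move=> c; apply/eqP; rewrite -normr_le0.
apply: (cvg_lower_bound c) => n; apply: le_trans (Ig_abs (intbleB (if_ n) igx)).
by rewrite IgB// I0 sub0r normrN.
Qed.

(** The primitive of the real part is identically zero, while by Lebesgue differentiation its
    derivative is the real part almost everywhere. *)
Lemma annih_Re_eq0 f : annih f -> ae01 (fun t => complex.Re (f t) = 0).
Proof.
move=> hf; pose g := (fun t => complex.Re (f t)) : R -> R; have [hf1 _] := hf.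
have ig : intble g := L1_Re hf1.
have mI := measurable_I01' (R := R).
have i1 : mu.-integrable setT (EFin \o (g \_ I)).
  have := (@integrable_mkcond _ (measurableTypeR R) R mu I (EFin \o g) mI).1 ig.
  by rewrite restrict_EFin.
have h0 y : mu.-integrable `]-oo, y] (EFin \o (g \_ I)).
  by apply: integrableS i1 => //; exact: measurable_itv.
have := FTC1Ny h0 (integrable_locally (measurable_I01 (R := R)) ig).
have -> : (fun x : R => \int[mu]_(t in `]-oo, x]) (g \_ I) t) = cst 0.
  apply/funext => x /=; rewrite -(annih_Re_itv x hf) /Ig -Rintegral_mkcondr setIC.
  rewrite Rintegral_mkcondr; congr Rintegral; apply/funext => t.
  rewrite /patch /= mem_setE in_itv /=.
  by case: ifP; rewrite ?mulr1 ?mulr0.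
apply: (filterS (F := almost_everywhere mu)) => t [_]; rewrite derive1_cst => /esym h It.
by move: h; rewrite /patch mem_set.
Qed.

Theorem fourier_unique f : L1 f -> (forall k, fourier f k = 0) -> ae01 (fun t => f t = 0).
Proof.
move=> hf cf; have af : annih f.
  by split => // k; rewrite -[k]opprK -fourierE.
(* Multiplication by [- i] turns the imaginary part into the real part. *)
have ai : annih (fun t => (Complex 0 (-1) : C) * f t).
  by have [_ _] := mult_cst (Complex 0 (-1)); exact.
apply: (ae01_filter2 _ (annih_Re_eq0 af) (annih_Re_eq0 ai)) => t.
rewrite Re_mul /= mul0r sub0r mulN1r opprK => h1 h2.
by apply: complex_ext.
Qed.

End FourierUniqueness.

(** * Almost-everywhere limits: Fatou, summable series, measurable limits *)

Section AlmostEverywhereLimits.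
Variable R : realType.
Local Notation mu := (@lebesgue_measure R).
Local Notation I := (@I01 R).

Lemma Ig_fatou (h_ : nat -> R -> R) (h : R -> R) (c : R) :
  (forall n, intble (h_ n)) -> (forall n t, 0 <= h_ n t) -> (forall n, Ig (h_ n) <= c) ->
  measurable_fun I h -> (forall t, 0 <= h t) ->
  ae01 (fun t => h_ ^~ t @ \oo --> h t) -> intble h /\ Ig h <= c.
Proof.
move=> ih h0 hc mh hh cv.
have mh_ n : measurable_fun (I : set (measurableTypeR R)) (EFin \o h_ n).
  by apply: measurable_EFin; exact: intble_meas.
have H : (\int[mu]_(t in I) (h t)%:E <= c%:E)%E.
  have -> : (\int[mu]_(t in I) (h t)%:E =
      \int[mu]_(t in I) limn_einf (fun n => (h_ n t)%:E))%E.
    apply: ge0_ae_eq_integral => //.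
    - exact: measurable_EFin.
    - have -> : (fun t : measurableTypeR R => limn_einf (fun n => (h_ n t)%:E)) =
          (fun t : measurableTypeR R => - limn_esup (fun n => - (h_ n t)%:E))%E.
        apply/funext => t; rewrite -[RHS]limn_einfN; congr limn_einf.
        by apply/funext => n; rewrite /= opprK.
      apply: (measurableT_comp (f := -%E)) => //.
      apply: measurable_fun_limn_esup => n.
      by apply: (measurableT_comp (f := -%E)) => //; exact: mh_.
    - by move=> t _; rewrite lee_fin.
    - move=> t _; rewrite limn_einf_lim; apply: lime_ge; first exact: is_cvg_einfs.
      by apply: nearW => n; apply: le_ereal_inf_tmp => _ [m _ <-]; rewrite lee_fin.
    apply: ae01_filter cv => t ct.
    have [|-> _ //] := @cvg_limn_einf_sup R (fun n => (h_ n t)%:E) (h t)%:E.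
    by apply: cvg_EFin => //; exact: nearW.
  have h0' n (t : measurableTypeR R) : I t -> (0 <= (EFin \o h_ n) t)%E.
    by move=> _; rewrite lee_fin.
  apply: (le_trans (fatou mu (@measurable_I01' R) mh_ h0')).
  rewrite limn_einf_lim; apply: lime_le; first exact: is_cvg_einfs.
  apply: nearW => n; apply: (@le_trans _ _ (\int[mu]_(t in I) (h_ n t)%:E)%E).
    by apply: ereal_inf_lbound; exists n => //=.
  by rewrite EFin_Ig// lee_fin.
have ihh : intble h.
  apply/integrableP; split; first exact: measurable_EFin.
  under eq_integral => t _ do rewrite /= ger0_norm//.
  by apply: le_lt_trans H _; exact: ltry.
by split => //; rewrite -lee_fin -EFin_Ig.
Qed.

Lemma sum_half_le (K : R) n : 0 <= K -> \sum_(0 <= i < n) K * 2^-1 ^+ i <= 2 * K.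
Proof.
move=> K0; suff -> : \sum_(0 <= i < n) K * 2^-1 ^+ i = 2 * K * (1 - 2^-1 ^+ n).
  by rewrite ler_piMr ?mulr_ge0// lerBlDr lerDl exprn_ge0// invr_ge0.
elim: n => [|n ih]; first by rewrite big_geq// expr0 subrr mulr0.
by rewrite big_nat_recr//= ih exprS; field.
Qed.

(** By monotone convergence the sum of the series has integral at most [2 K], so it is finite almost
    everywhere. *)
Lemma ae_summable (d_ : nat -> R -> R) (K : R) : 0 <= K ->
  (forall n, intble (d_ n)) -> (forall n t, 0 <= d_ n t) ->
  (forall n, Ig (d_ n) <= K * 2^-1 ^+ n) ->
  ae01 (fun t => cvgn (series (d_ ^~ t))).
Proof.
move=> K0 id d0 dK.
pose S (t : measurableTypeR R) := (\sum_(0 <= n <oo) (d_ n t)%:E)%E.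
have md n : measurable_fun (I : set (measurableTypeR R)) (EFin \o d_ n).
  by apply: measurable_EFin; exact: intble_meas.
have mS : measurable_fun (I : set (measurableTypeR R)) S.
  apply: (@ge0_emeasurable_sum _ _ R I (fun n (t : measurableTypeR R) => (d_ n t)%:E)
    xpredT) => [n t _ _|n _]; first by rewrite lee_fin.
  exact: md.
have S0 t : (0 <= S t)%E by apply: nneseries_ge0 => n _ _; rewrite lee_fin.
have iS : mu.-integrable I S.
  apply/integrableP; split => //.
  under eq_integral => t _ do rewrite gee0_abs//.
  rewrite integral_nneseries//; last by move=> n t _; rewrite lee_fin.
  apply: (@le_lt_trans _ _ (2 * K)%:E); last exact: ltry.
  apply: lime_le.
    by apply: is_cvg_nneseries => n _ _; apply: integral_ge0 => t _; rewrite lee_fin.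
  apply: nearW => n; apply: (@le_trans _ _ (\sum_(0 <= i < n) K * 2^-1 ^+ i)%:E).
    rewrite -sumEFin; apply: lee_sum => i _.
    by rewrite EFin_Ig// lee_fin.
  by rewrite lee_fin; exact: sum_half_le.
have := integrable_ae (@measurable_I01' R) iS.
apply: ae01_filter => t Sfin; apply: nondecreasing_is_cvgn.
  by apply: nondecreasing_series => n _ _; exact: d0.
exists (fine (S t)) => _ [n _ <-]; rewrite -lee_fin fineK//.
rewrite /series /= -sumEFin; apply: nneseries_lim_ge => k _ _.
by rewrite lee_fin.
Qed.

Lemma telescope_cvg (u d : nat -> R) : cvgn (series d) ->
  (forall n, `|u n.+1 - u n| <= d n) -> cvgn u.
Proof.
move=> cd ud; have c : cvgn (series (telescope u)).
  apply: normed_cvg; apply: (series_le_cvg _ _ _ cd) => n; last exact: ud.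
    exact: normr_ge0.
  by apply: le_trans (ud n).
have -> : u = (fun n => u 0%N + series (telescope u) n).
  by apply/funext => n; exact: eq_sum_telescope.
by apply: is_cvgD => //; exact: is_cvg_cst.
Qed.

(* The limit is taken as an upper limit so as to be measurable everywhere, not only
   where the sequence converges. *)
Lemma ae_limit (u_ : nat -> R -> R) : (forall n, measurable_fun I (u_ n)) ->
  ae01 (fun t => cvgn (u_ ^~ t)) ->
  exists2 u : R -> R, measurable_fun I u & ae01 (fun t => u_ ^~ t @ \oo --> u t).
Proof.
move=> mu_ cu; exists (fun t => fine (limn_esup (fun n => (u_ n t)%:E))).
  apply: (measurableT_comp (f := fine)); first exact: fine_measurable.
  apply: measurable_fun_limn_esup => n; exact/measurable_EFinP.
apply: ae01_filter cu => t /cvg_ex[l cl].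
have [//|_ ->//] := @cvg_limn_einf_sup R (fun n => (u_ n t)%:E) l%:E.
by apply: cvg_EFin => //; exact: nearW.
Qed.

End AlmostEverywhereLimits.

(** * Weighted [L2]: completeness, and minimal-norm elements of closed convex sets *)

Section WeightedL2.
Variable R : realType.
Local Notation C := R[i].
Local Notation I := (@I01 R).
Implicit Types (f g F G : R -> C).

Lemma cmod_parallelogram (z w : C) :
  cmod (z + w) ^+ 2 + cmod (z - w) ^+ 2 = 2 * cmod z ^+ 2 + 2 * cmod w ^+ 2.
Proof. by rewrite !cmod_sqr !Re_add !Im_add !Re_opp !Im_opp; ring. Qed.

Lemma cmodD_sqr (z w : C) : cmod (z + w) ^+ 2 <= 2 * cmod z ^+ 2 + 2 * cmod w ^+ 2.
Proof. by rewrite -cmod_parallelogram lerDl sqr_ge0. Qed.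

Lemma cmodD_sqrE (z w c : C) : cmod (z + c * w) ^+ 2 =
  cmod z ^+ 2 + 2 * complex.Re (conjc c * (conjc w * z)) + cmod c ^+ 2 * cmod w ^+ 2.
Proof.
rewrite -exprMn -cmodM !cmod_sqr !(Re_add, Im_add, Re_mul, Im_mul, Re_conjc, Im_conjc).
by ring.
Qed.

(** The arithmetic-geometric mean inequality, applied pointwise under the integral in place of
    Cauchy-Schwarz. *)
Lemma mean_ge_sqrt (x a b : R) : 0 <= a -> 0 <= b -> x ^+ 2 <= a * b -> x <= (a + b) / 2.
Proof.
move=> a0 b0 h; rewrite leNgt; apply/negP => h1.
have := sqr_ge0 (a - b); nra.
Qed.

Lemma cvg_shift_addl N (u : nat -> R) (l : R) : u @ \oo --> l ->
  u (N + n)%N @[n --> \oo] --> l.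
Proof.
move=> h; rewrite (_ : (fun n => u (N + n)%N) = [sequence u (n + N)%N]_n).
  by rewrite cvg_shiftn.
by apply/funext => n; rewrite addnC.
Qed.

Definition L2w (W : R -> R) f :=
  cmeasurable f /\ intble (fun t => cmod (f t) ^+ 2 * W t).

Definition n2 (W : R -> R) f : R := Ig (fun t => cmod (f t) ^+ 2 * W t).

Variable W : R -> R.
(** A weight bounded below by 1 makes weighted convergence imply ordinary [L2] convergence, hence
    [L1] convergence on the interval. *)
Hypotheses (W1 : forall t, 1 <= W t) (mW : measurable_fun I W).

Let W0 t : 0 <= W t. Proof. exact: le_trans (W1 t). Qed.

Lemma sqrW_ge0 f t : 0 <= cmod (f t) ^+ 2 * W t.
Proof. by rewrite mulr_ge0// sqr_ge0. Qed.

Lemma measurable_sqrW f : cmeasurable f ->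
  measurable_fun I (fun t => cmod (f t) ^+ 2 * W t).
Proof.
by move=> mf; apply: measurable_funM => //; apply: measurable_funX; exact: cmeas_cmod.
Qed.

Lemma n2_ge0 f : 0 <= n2 W f.
Proof. by apply: Ig_ge0 => t; exact: sqrW_ge0. Qed.

Lemma L2wZ (c : C) f : L2w W f -> L2w W (fun t => c * f t).
Proof.
move=> [mf hf]; split; first by apply: cmeasM => //; exact: cmeas_cst.
under eq_fun do rewrite cmodM exprMn -mulrA.
exact: intbleZ.
Qed.

Lemma n2Z (c : C) f : L2w W f -> n2 W (fun t => c * f t) = cmod c ^+ 2 * n2 W f.
Proof.
move=> [mf hf]; rewrite /n2 -IgZ//; congr Ig; apply/funext => t.
by rewrite cmodM exprMn mulrA.
Qed.

Lemma L2wD f g : L2w W f -> L2w W g -> L2w W (fun t => f t + g t).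
Proof.
move=> [mf hf] [mg hg]; split; first exact: cmeasD.
apply: (intble_le _ (intbleD (intbleZ 2 hf) (intbleZ 2 hg))).
  exact: measurable_sqrW (cmeasD mf mg).
apply: ae01T => t; rewrite ger0_norm; last exact: (sqrW_ge0 (fun t => f t + g t)).
by apply: le_trans (ler_wpM2r (W0 t) (cmodD_sqr _ _)) _; rewrite mulrDl !mulrA.
Qed.

Lemma L2wB f g : L2w W f -> L2w W g -> L2w W (fun t => f t - g t).
Proof.
move=> hf /(L2wZ (-1)); under eq_fun do rewrite mulN1r.
exact: L2wD.
Qed.

Lemma n2_parallelogram f g : L2w W f -> L2w W g ->
  n2 W (fun t => f t + g t) + n2 W (fun t => f t - g t) = 2 * n2 W f + 2 * n2 W g.
Proof.
move=> hf hg; have [_ hfg] := L2wD hf hg; have [_ hfg'] := L2wB hf hg.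
have [_ {}hf] := hf; have [_ {}hg] := hg.
rewrite /n2 -IgD// -!IgZ// -IgD; try exact: intbleZ.
by congr Ig; apply/funext => t; rewrite -mulrDl cmod_parallelogram mulrDl !mulrA.
Qed.

Lemma L2w_inner f g : L2w W f -> L2w W g ->
  L1 (fun t => conjc (g t) * f t * (W t)%:C%C).
Proof.
move=> [mf hf] [mg hg]; apply: (L1_le _ (intbleZ 2^-1 (intbleD hf hg))).
  by apply: cmeasM; [apply: cmeasM => //; exact: cmeas_conj|exact: cmeas_real].
apply: ae01T => t; rewrite !cmodM cmod_conj cmod_real ger0_norm// mulrC.
have : 0 <= W t * (cmod (f t) - cmod (g t)) ^+ 2 by rewrite mulr_ge0// sqr_ge0.
by move=> h; nra.
Qed.

Lemma n2_expand f g (c : C) : L2w W f -> L2w W g ->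
  n2 W (fun t => f t + c * g t) =
  n2 W f + 2 * complex.Re (conjc c * cint (fun t => conjc (g t) * f t * (W t)%:C%C))
  + cmod c ^+ 2 * n2 W g.
Proof.
move=> hf hg; have hi := L2w_inner hf hg.
have [_ {}hf] := hf; have [_ {}hg] := hg.
rewrite -cintZ//=; have hr := L1_Re (L1Z (conjc c) hi).
rewrite /n2 -!IgZ// -!IgD//; try exact: intbleZ; last first.
  by apply: intbleD => //; exact: intbleZ.
congr Ig; apply/funext => t; rewrite cmodD_sqrE.
have -> : complex.Re (conjc c * (conjc (g t) * f t * (W t)%:C%C)) =
    complex.Re (conjc c * (conjc (g t) * f t)) * W t.
  by rewrite mulrA Re_mul /= mulr0 subr0.
by ring.
Qed.

(** The domination by [v W] expresses, without dividing, that [u] is square-integrable for the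
    weight [1 / W], that is, in the dual of the weighted space. *)
Lemma L2w_L1 f u (v : R -> R) : L2w W f -> cmeasurable u -> intble v ->
  (forall t, 0 <= v t) -> (forall t, cmod (u t) ^+ 2 <= v t * W t) ->
  L1 (fun t => f t * u t).
Proof.
move=> [mf hf] mu' iv v0 uv.
apply: (L1_le (cmeasM mf mu') (intbleZ 2^-1 (intbleD hf iv))).
apply: ae01T => t; rewrite [leRHS]mulrC; apply: mean_ge_sqrt => //; first exact: sqrW_ge0.
rewrite cmodM exprMn -mulrA ler_wpM2l ?sqr_ge0// mulrC; exact: uv.
Qed.

Lemma L2w_norm1 f u (v : R -> R) (e : R) : L2w W f -> cmeasurable u -> intble v ->
  (forall t, 0 <= v t) -> (forall t, cmod (u t) ^+ 2 <= v t * W t) ->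
  0 < e -> n2 W f <= e ^+ 2 -> norm1 (fun t => f t * u t) <= e * (1 + Ig v) / 2.
Proof.
move=> hf mu' iv v0 uv e0 fe; have [mf hf2] := hf.
(* The mean inequality is applied to [|f|^2 W / e] and [e v]; this split makes both terms of order
   [e] when the squared norm is at most [e^2]. *)
apply: (@le_trans _ _ (2^-1 * (e^-1 * n2 W f + e * Ig v))); last first.
  rewrite mulrC ler_wpM2r ?invr_ge0// mulrDr mulr1 lerD2r.
  by rewrite ler_pdivrMl.
rewrite /n2 -!IgZ// -IgD; try exact: intbleZ.
rewrite -IgZ; last by apply: intbleD; exact: intbleZ.
apply: Ig_le.
- exact: L1_cmod (L2w_L1 hf mu' iv v0 uv).
- by apply: intbleZ; apply: intbleD; exact: intbleZ.
apply: ae01T => t; rewrite [leRHS]mulrC; apply: mean_ge_sqrt => //.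
- by rewrite mulr_ge0 ?invr_ge0 ?(ltW e0)//; exact: sqrW_ge0.
- by rewrite mulr_ge0// ltW.
rewrite [leRHS](_ : _ = cmod (f t) ^+ 2 * (v t * W t)).
  by rewrite cmodM exprMn ler_wpM2l ?sqr_ge0.
by field; rewrite gt_eqF.
Qed.

Lemma L2w_small_norm1 F u (v : R -> R) (P : (R -> C) -> Prop) : L2w W F ->
  (forall G, P G -> L2w W G) -> cmeasurable u -> intble v ->
  (forall t, 0 <= v t) -> (forall t, cmod (u t) ^+ 2 <= v t * W t) ->
  (forall e, 0 < e -> exists2 G, P G & n2 W (fun t => F t - G t) <= e) ->
  forall e, 0 < e -> exists2 G, P G & norm1 (fun t => F t * u t - G t * u t) <= e.
Proof.
move=> hF PL mu' iv v0 uv h e e0.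
have k0 : 0 < (1 + Ig v) / 2 by rewrite divr_gt0// ltr_pwDl// Ig_ge0.
pose d := e / ((1 + Ig v) / 2).
have d0 : 0 < d by rewrite divr_gt0.
have [G PG hG] := h (d ^+ 2) (exprn_gt0 _ d0).
exists G => //; under eq_fun do rewrite -mulrBl.
apply: le_trans (L2w_norm1 (L2wB hF (PL _ PG)) mu' iv v0 uv d0 hG) _.
by rewrite /d -mulrA divfK// gt_eqF.
Qed.

(** With [cint_closedL2], this checks that the constraint sets of the minimization problems are
    closed: pairing with a fixed dual element [u] is continuous into [L1]. *)
Lemma H1_closedL2 F u (v : R -> R) (P : (R -> C) -> Prop) : L2w W F ->
  (forall G, P G -> L2w W G) -> cmeasurable u -> intble v ->
  (forall t, 0 <= v t) -> (forall t, cmod (u t) ^+ 2 <= v t * W t) ->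
  (forall G, P G -> H1 (fun t => G t * u t)) ->
  (forall e, 0 < e -> exists2 G, P G & n2 W (fun t => F t - G t) <= e) ->
  H1 (fun t => F t * u t).
Proof.
move=> hF PL mu' iv v0 uv PH h; apply: H1_closed => [|e e0].
  exact: L2w_L1 uv.
have [G PG hG] := L2w_small_norm1 hF PL mu' iv v0 uv h e0.
by exists (fun t => G t * u t) => //; exact: PH.
Qed.

Lemma cint_closedL2 F u (v : R -> R) (c : C) (P : (R -> C) -> Prop) : L2w W F ->
  (forall G, P G -> L2w W G) -> cmeasurable u -> intble v ->
  (forall t, 0 <= v t) -> (forall t, cmod (u t) ^+ 2 <= v t * W t) ->
  (forall G, P G -> cint (fun t => G t * u t) = c) ->
  (forall e, 0 < e -> exists2 G, P G & n2 W (fun t => F t - G t) <= e) ->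
  cint (fun t => F t * u t) = c.
Proof.
move=> hF PL mu' iv v0 uv Pc h; apply/eqP; rewrite -subr_eq0; apply/eqP.
apply: cmod_eq0; apply/eqP; rewrite eq_le cmod_ge0 andbT.
apply/ler_addgt0Pl => e e0; rewrite addr0.
have e2 : 0 < e / 2 by rewrite divr_gt0.
have [G PG hG] := L2w_small_norm1 hF PL mu' iv v0 uv h e2.
have L1F := L2w_L1 hF mu' iv v0 uv; have L1G := L2w_L1 (PL _ PG) mu' iv v0 uv.
rewrite -(Pc _ PG) -cintB//; apply: le_trans (cmod_cint _) _; first exact: L1B.
by rewrite -ler_pdivlMl// mulrC.
Qed.

(** The rate [4^-1 ^+ i] for squared norms makes consecutive differences [O(2^-n)] in [L1], hence
    summable almost everywhere. The last clause, lower semicontinuity of the norm, carries an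
    infimum over to the limit. *)
Lemma L2w_complete (G : nat -> R -> C) : (forall n, L2w W (G n)) ->
  (forall i j, (i <= j)%N -> n2 W (fun t => G j t - G i t) <= 4^-1 ^+ i) ->
  exists F, [/\ L2w W F, forall n, n2 W (fun t => F t - G n t) <= 4^-1 ^+ n
    & forall c N, (forall n, (N <= n)%N -> n2 W (G n) <= c) -> n2 W F <= c].
Proof.
move=> hG hn; pose d n t := cmod (G n.+1 t - G n t).
have hd n : L2w W (fun t => G n.+1 t - G n t) by exact: L2wB.
have id n : intble (d n).
  have := @L2w_L1 _ (fun=> 1) (fun=> 1) (hd n) (cmeas_cst _) (intble_cst _)
    (fun=> ler01) (fun t => _).
  under eq_fun do rewrite mulr1.
  by move=> H; apply: L1_cmod; apply: H => t; rewrite cmod1 expr1n mul1r.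
have cvd : ae01 (fun t => cvgn (series (d ^~ t))).
  apply: (@ae_summable R d 1) => // [n t|n]; first exact: cmod_ge0.
  have := @L2w_norm1 _ (fun=> 1) (fun=> 1) (2^-1 ^+ n) (hd n) (cmeas_cst _)
    (intble_cst _) (fun=> ler01).
  rewrite Ig_cst mul1r -[1 + 1]/(2%:R) mulfK// => H.
  have -> : Ig (d n) = norm1 (fun t => (G n.+1 t - G n t) * 1).
    by congr Ig; apply/funext => t; rewrite mulr1.
  apply: H => [t||]; first by rewrite cmod1 expr1n mul1r.
    by rewrite exprn_gt0// invr_gt0.
  apply: le_trans (hn _ _ (leqnSn n)) _.
  by rewrite -exprM mulnC exprM (_ : 4^-1 = 2^-1 ^+ 2 :> R)//; field.
have [F1 mF1 cF1] : exists2 u : R -> R, measurable_fun I u &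
    ae01 (fun t => complex.Re (G n t) @[n --> \oo] --> u t).
  apply: ae_limit => [n|]; first by case: (hG n) => -[].
  apply: ae01_filter cvd => t c; apply: (telescope_cvg c) => n.
  by apply: le_trans (Re_cmod _); rewrite Re_add Re_opp.
have [F2 mF2 cF2] : exists2 u : R -> R, measurable_fun I u &
    ae01 (fun t => complex.Im (G n t) @[n --> \oo] --> u t).
  apply: ae_limit => [n|]; first by case: (hG n) => -[].
  apply: ae01_filter cvd => t c; apply: (telescope_cvg c) => n.
  by apply: le_trans (Im_cmod _); rewrite Im_add Im_opp.
pose F t : C := Complex (F1 t) (F2 t).
have mF : cmeasurable F by [].
have cv H N : ae01 (fun t => cmod (G (N + n)%N t - H t) ^+ 2 * W t @[n --> \oo] -->
    cmod (F t - H t) ^+ 2 * W t).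
  apply: (ae01_filter2 _ cF1 cF2) => t c1 c2; apply: cvgM; last exact: cvg_cst.
  have {}c1 := cvg_shift_addl N c1; have {}c2 := cvg_shift_addl N c2.
  under eq_fun do rewrite cmod_sqr Re_add Im_add.
  rewrite cmod_sqr Re_add Im_add /=.
  by apply: cvgD; apply: cvgM; apply: cvgD => //; exact: cvg_cst.
(* Fatou along the tail starting at [N]: with [H = G n] it gives the rate of convergence, with
   [H = 0] the bound on the norm. *)
have fatou H N c : L2w W H -> (forall n, n2 W (fun t => G (N + n)%N t - H t) <= c) ->
    L2w W (fun t => F t - H t) /\ n2 W (fun t => F t - H t) <= c.
  move=> hH hc; have [mH _] := hH.
  have mFH : cmeasurable (fun t => F t - H t) by exact: cmeasB.
  have [] := @Ig_fatou R (fun n t => cmod (G (N + n)%N t - H t) ^+ 2 * W t)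
      (fun t => cmod (F t - H t) ^+ 2 * W t) c _ _ hc _ _ (cv H N).
  - by move=> n; have [] := L2wB (hG (N + n)%N) hH.
  - by move=> n t; exact: (sqrW_ge0 (fun t => G (N + n)%N t - H t)).
  - exact: measurable_sqrW.
  - by move=> t; exact: (sqrW_ge0 (fun t => F t - H t)).
  by move=> ? ?; split.
have L20 : L2w W (fun=> 0).
  have := L2wZ 0 (hG 0%N); by under eq_fun do rewrite mul0r.
have hF0 n := fatou (G n) n _ (hG n) (fun k => hn n (n + k)%N (leq_addr k n)).
exists F; split.
- have [h _] := hF0 0%N; have := L2wD h (hG 0%N).
  by under eq_fun do rewrite subrK.
- by move=> n; have [] := hF0 n.
move=> c N hc; have [|_] := fatou (fun=> 0) N c L20.
  by move=> n; under eq_fun do rewrite subr0; apply: hc; exact: leq_addr.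
by under eq_fun do rewrite subr0.
Qed.

Lemma min_exists (B : (R -> C) -> Prop) : (exists F, B F) ->
  (forall F, B F -> L2w W F) ->
  (forall F G, B F -> B G -> B (fun t => (F t + G t) / 2)) ->
  (forall F, L2w W F ->
    (forall e, 0 < e -> exists2 G, B G & n2 W (fun t => F t - G t) <= e) -> B F) ->
  exists2 F, B F & forall G, B G -> n2 W F <= n2 W G.
Proof.
move=> [F0 BF0] BL Bmid Bclosed.
pose A := [set n2 W G | G in B]; have infA : has_inf A.
  split; first by exists (n2 W F0), F0.
  by exists 0 => _ [G _ <-]; exact: n2_ge0.
pose m := inf A.
have mle G : B G -> m <= n2 W G.
  by move=> BG; apply: ge_inf; [exact: infA.2|exists G].
(* By the parallelogram law, two elements within [dl i] of the infimum are at squared distance at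
   most [4 dl i], since their midpoint is not below the infimum; the division by 4 turns this into
   [4^-1 ^+ i]. *)
pose dl n : R := 4^-1 ^+ n / 4.
have /choice[G hG] : forall n, exists G, B G /\ n2 W G <= m + dl n.
  move=> n; have dn : 0 < dl n by rewrite divr_gt0// exprn_gt0// invr_gt0.
  by have [_ [G BG <-] h] := inf_adherent dn infA; exists G; split => //; exact: ltW.
have dle i j : (i <= j)%N -> dl j <= dl i.
  move=> ij; rewrite ler_wpM2r ?invr_ge0//; apply: ler_wiXn2l => //; by [|lra].
have LG n : L2w W (G n) by apply: BL; case: (hG n).
have cG i j : (i <= j)%N -> n2 W (fun t => G j t - G i t) <= 4^-1 ^+ i.
  move=> ij; have := n2_parallelogram (LG j) (LG i).
  have := mle _ (Bmid _ _ (hG j).1 (hG i).1).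
  have -> : (fun t => (G j t + G i t) / 2) = (fun t => 2^-1 * (G j t + G i t)).
    by apply/funext => t; rewrite mulrC.
  rewrite n2Z; last exact: L2wD.
  have -> : cmod (2^-1 : C) ^+ 2 = 4^-1.
    rewrite (_ : (2^-1 : C) = (2^-1 : R)%:C%C); last by rewrite fmorphV rmorph_nat.
    by rewrite cmod_real ger0_norm ?invr_ge0//; field.
  have := (hG j).2; have := (hG i).2; have := dle _ _ ij.
  have -> : 4^-1 ^+ i = 4 * dl i by rewrite /dl; field.
  by move=> *; lra.
have [F [LF hF hc]] := L2w_complete LG cG.
have cvd : 4^-1 ^+ n @[n --> \oo] --> (0 : R).
  by apply: cvg_expr; rewrite ger0_norm ?invr_ge0// invf_lt1// ltr1n.
exists F.
  apply: Bclosed => // e e0.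
  have /cvgr0Pnorm_le /(_ e e0) [N _ hN] := cvd.
  exists (G N); first by case: (hG N).
  apply: le_trans (hF N) _; apply: le_trans (ler_norm _) (hN N _).
  exact: leqnn.
move=> H BH; apply: le_trans (mle _ BH).
apply/ler_addgt0Pl => e e0; rewrite addrC.
have e4 : 0 < e * 4 by rewrite mulr_gt0.
have /cvgr0Pnorm_le /(_ _ e4) [N _ hN] := cvd.
apply: (hc _ N) => n Nn; apply: le_trans (hG n).2 _; rewrite lerD2l.
by rewrite /dl ler_pdivrMr//; apply: le_trans (ler_norm _) (hN n _).
Qed.

Lemma min_orthogonal (B : (R -> C) -> Prop) F g : L2w W F -> L2w W g ->
  (forall G, B G -> n2 W F <= n2 W G) -> (forall c : C, B (fun t => F t + c * g t)) ->
  cint (fun t => conjc (g t) * F t * (W t)%:C%C) = 0.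
Proof.
move=> hF hg hmin hB; set a := cint _.
(* The variation is by [c = - s a]. The optimal step would be the inverse of [n2 W g]; adding 1
   covers [n2 W g = 0] and still keeps [s * n2 W g] below 2. *)
pose s : R := (1 + n2 W g)^-1; have g0 := n2_ge0 g.
have s0 : 0 < s by rewrite invr_gt0; lra.
have := hmin _ (hB (- (s%:C%C * a))).
have E : complex.Re (conjc (- (s%:C%C * a)) * a) = - (s * cmod a ^+ 2).
  by rewrite cmod_sqr; case: (a) => x y /=; ring.
rewrite n2_expand// -/a E -addrA lerDl cmodN cmodM cmod_real exprMn.
rewrite real_normK ?num_real//.
have -> : 2 * - (s * cmod a ^+ 2) + s ^+ 2 * cmod a ^+ 2 * n2 W g =
   s * cmod a ^+ 2 * (s * n2 W g - 2) by ring.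
have h : s * n2 W g - 2 < 0.
  by rewrite subr_lt0 /s ltr_pdivrMl; lra.
have [/eqP a0|a0] := eqVneq (cmod a) 0.
  by move=> _; apply: cmod_eq0; exact/eqP.
have : 0 < s * cmod a ^+ 2 by rewrite mulr_gt0// exprn_even_gt0.
by move=> h1; rewrite pmulr_rge0// subr_ge0 leNgt -subr_lt0 h.
Qed.

End WeightedL2.

(** * Bounded multipliers carrying [H1] functions into [H2], from a Szego-type minimum problem *)

Section OuterApproximation.
Variable R : realType.
Local Notation C := R[i].
Local Notation mu := (@lebesgue_measure R).
Local Notation I := (@I01 R).
Implicit Types (f g F G u : R -> C).

Lemma conjcM (a b : C) : conjc (a * b) = conjc a * conjc b.
Proof. exact: rmorphM. Qed.

Lemma H1_one (c : C) : H1 (fun _ : R => c).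
Proof. by apply: H1_cst => n; exact: cint_zpow. Qed.

Lemma cint_zpowN (k : R -> R) (n : int) : intble k ->
  cint (fun t => zpow (- n) t * (k t)%:C%C) = conjc (cint (fun t => zpow n t * (k t)%:C%C)).
Proof.
move=> ik; rewrite -cint_conj; last exact/L1_zpow/L1_real.
by congr cint; apply/funext => t; rewrite conjcM conj_zpow conjc_real.
Qed.

(** Coefficients of a real function at opposite indices are conjugate, so those at positive indices
    vanish too; subtracting the mean removes the one at 0. *)
Lemma H1_real_const (k : R -> R) : intble k -> H1 (fun t => (k t)%:C%C) ->
  ae01 (fun t => k t = Ig k).
Proof.
move=> ik hk; pose g t := k t - Ig k.
have ig : intble g by apply: intbleB => //; exact: intble_cst.
have gE : (fun t => (g t)%:C%C) = (fun t => (k t)%:C%C - (Ig k)%:C%C : C).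
  by apply/funext => t; rewrite /g rmorphB.
have hg : H1 (fun t => (g t)%:C%C) by rewrite gE; apply: H1B => //; exact: H1_one.
have /H1P[L1g cg] := hg.
have c0 (n : nat) : cint (fun t => zpow n t * (g t)%:C%C) = 0.
  case: n => [|n]; last exact: cg.
  under eq_fun do rewrite zpow0 mul1r.
  by rewrite cint_real /g IgB ?Ig_cst ?subrr//; exact: intble_cst.
have /ae01_filter : ae01 (fun t => (g t)%:C%C = 0 :> C).
  apply: fourier_unique => // k'; rewrite fourierE.
  case: k' => [n|n]; last by rewrite NegzE opprK; exact: c0.
  by rewrite cint_zpowN// c0 conjc0.
by apply => t -[] /eqP; rewrite subr_eq0 => /eqP.
Qed.

Section Szego.
Variables (u u' : R -> C) (eps : R).
Hypotheses (hu : H1 u) (hu' : H1 u') (uu' : forall t, cmod (u' t) <= cmod (u t)).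
Hypothesis eps0 : 0 < eps.

(** The weight grows with [|u|], so the minimizer is forced to be small exactly where [u] is
    large. *)
Let W t : R := 1 + eps * cmod (u t).

Let W1 t : 1 <= W t.
Proof. by rewrite lerDl mulr_ge0 ?cmod_ge0// ltW. Qed.

Let iW : intble W.
Proof. by apply: intbleD; [exact: intble_cst|exact/intbleZ/L1_cmod/H1_L1]. Qed.

Let mW : measurable_fun I W. Proof. exact: intble_meas. Qed.

(* Putting the products [F u] and [F u'] into the constraints makes the minimizer a
   multiplier of both, although [H1] is not yet known to be a module over bounded [H1]. *)
Let A F := [/\ L2w W F, H1 F, cint F = 1, H1 (fun t => F t * u t) & H1 (fun t => F t * u' t)].

Let A_combine F G (a b : C) : A F -> A G -> a + b = 1 -> A (fun t => a * F t + b * G t).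
Proof.
move=> [lF hF cF huF huF'] [lG hG cG huG huG'] ab; split.
- by apply: L2wD => //; exact: L2wZ.
- by apply: H1D; exact: H1Z.
- rewrite cintD; try exact/L1Z/H1_L1.
  by rewrite !cintZ ?cF ?cG ?mulr1//; exact: H1_L1.
- under eq_fun do rewrite mulrDl -!mulrA; by apply: H1D; exact: H1Z.
- under eq_fun do rewrite mulrDl -!mulrA; by apply: H1D; exact: H1Z.
Qed.

Let A_closed F : L2w W F ->
  (forall e, 0 < e -> exists2 G, A G & n2 W (fun t => F t - G t) <= e) -> A F.
Proof.
move=> hF h; have AL G : A G -> L2w W G by case.
have one1 t : cmod (1 : C) ^+ 2 <= 1 * W t by rewrite cmod1 expr1n mul1r.
(* [u] itself is an admissible dual element, with [v = |u| / eps], because [W] contains the term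
   [eps |u|]. *)
have vW t : cmod (u t) ^+ 2 <= eps^-1 * cmod (u t) * W t.
  rewrite mulrDr mulr1 (_ : _ * _ * (eps * cmod (u t)) = cmod (u t) ^+ 2).
    by rewrite lerDr mulr_ge0 ?invr_ge0 ?cmod_ge0// ltW.
  by field; rewrite gt_eqF.
have iv : intble (fun t => eps^-1 * cmod (u t)) by exact/intbleZ/L1_cmod/H1_L1.
have v0 t : 0 <= eps^-1 * cmod (u t) by rewrite mulr_ge0 ?invr_ge0 ?cmod_ge0// ltW.
split => //.
- have := H1_closedL2 W1 mW hF AL (cmeas_cst 1) (intble_cst 1) (fun=> ler01) one1 _ h.
  under eq_fun do rewrite mulr1; apply => G [_ hG _ _ _].
  by under eq_fun do rewrite mulr1.
- have := cint_closedL2 (c := 1) W1 mW hF AL (cmeas_cst 1) (intble_cst 1) (fun=> ler01) one1 _ h.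
  under eq_fun do rewrite mulr1; apply => G [_ _ hG _ _].
  by under eq_fun do rewrite mulr1.
- apply: (H1_closedL2 W1 mW hF AL (H1_meas hu) iv v0 vW _ h) => G.
  by case.
- apply: (H1_closedL2 W1 mW hF AL (H1_meas hu') iv v0 _ _ h) => [t|G].
    by apply: le_trans (vW t); rewrite lerXn2r ?nnegrE ?cmod_ge0.
  by case.
Qed.

(** The minimizer [F] of mean 1 is orthogonal to every [z^(n+1) F], so [|F|^2 W] is constant. The
    constant is the minimum, hence at most the value [1 + eps * norm1 u] of the competitor 1. This
    bounds [F], and controls its distance to 1 as well. *)
Lemma szego_min : exists F, [/\ cmeasurable F, H1 (fun t => F t * u t),
  H1 (fun t => F t * u' t),
  ae01 (fun t => cmod (F t) ^+ 2 * (1 + eps * cmod (u t)) <= 1 + eps * norm1 u)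
  & intble (fun t => cmod (F t - 1) ^+ 2) /\
    Ig (fun t => cmod (F t - 1) ^+ 2) <= eps * norm1 u].
Proof.
have A1 : A (fun=> 1).
  split; [|exact: H1_one|exact: cint_cst| |]; try by under eq_fun do rewrite mul1r.
  split; first exact: cmeas_cst.
  by under eq_fun do rewrite cmod1 expr1n mul1r.
have [//|G []//|G H AG AH|//|F AF Fmin] := @min_exists R W W1 mW A.
- by exists (fun=> 1).
- rewrite (_ : (fun t => _) = (fun t => 2^-1 * G t + 2^-1 * H t)).
    by apply: A_combine => //; field.
  by apply/funext => t; field.
- have [lF hF cF hFu hFu'] := AF; have [mF iF] := lF.
have IgW : n2 W (fun=> 1) = 1 + eps * norm1 u.
  rewrite /n2; under eq_fun do rewrite cmod1 expr1n mul1r.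
  by rewrite IgD ?Ig_cst ?IgZ//;
    [exact/L1_cmod/H1_L1|exact: intble_cst|exact/intbleZ/L1_cmod/H1_L1].
have cF0 (n : nat) : cint (fun t => zpow n.+1 t * F t) = 0 by have /H1P[_] := hF; exact.
have orth (n : nat) : cint (fun t => conjc (zpow n.+1 t * F t) * F t * (W t)%:C%C) = 0.
  have lz : L2w W (fun t => zpow n.+1 t * F t).
    split; first by apply: cmeasM => //; exact: cmeas_zpow.
    by under eq_fun do rewrite cmodM cmod_zpow mul1r.
  (* Adding a multiple of [z^(n+1) F] keeps the mean equal to 1, since [F] is in [H1]. *)
  apply: (min_orthogonal W1 mW lF lz Fmin) => c; split.
  - by apply: L2wD => //; exact: L2wZ.
  - by apply: H1D => //; apply: H1Z; exact: H1_zpow.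
  - rewrite cintD; [|exact: H1_L1|exact/L1Z/L1_zpow/H1_L1].
    by rewrite cintZ ?cF0 ?mulr0 ?addr0//; exact/L1_zpow/H1_L1.
  - under eq_fun do rewrite mulrDl -!mulrA.
    by apply: H1D => //; apply: H1Z; exact: H1_zpow.
  - under eq_fun do rewrite mulrDl -!mulrA.
    by apply: H1D => //; apply: H1Z; exact: H1_zpow.
have hk : H1 (fun t => (cmod (F t) ^+ 2 * W t)%:C%C).
  apply/H1P; split=> [|n]; first exact: L1_real.
  rewrite -[n.+1 : int]opprK cint_zpowN//.
  rewrite (_ : (fun t => _) = (fun t => conjc (zpow n.+1 t * F t) * F t * (W t)%:C%C)).
    by rewrite orth conjc0.
  apply/funext => t; rewrite conjcM conj_zpow rmorphM /= -mulc_conj.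
  by rewrite [F t * _]mulrC !mulrA.
have kc := H1_real_const iF hk.
have nF : n2 W F <= 1 + eps * norm1 u by rewrite -IgW; exact: Fmin.
have iF2 : intble (fun t => cmod (F t) ^+ 2).
  apply: (intble_le _ iF); first by apply: measurable_funX; exact: cmeas_cmod.
  by apply: ae01T => t; rewrite ger0_norm ?sqr_ge0// ler_peMr// sqr_ge0.
(* Since [F] has mean 1, integrating this gives the integral of [|F|^2] minus 1, at most
   [eps * norm1 u]. *)
have E : (fun t => cmod (F t - 1) ^+ 2) =
    (fun t => cmod (F t) ^+ 2 - 2 * complex.Re (F t) + 1).
  by apply/funext => t; rewrite !cmod_sqr Re_add Im_add /=; ring.
have iR : intble (fun t => complex.Re (F t)) by exact/L1_Re/H1_L1.
have iB : intble (fun t => cmod (F t) ^+ 2 - 2 * complex.Re (F t)).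
  by apply: intbleB => //; exact: intbleZ.
exists F; split => //; first by apply: ae01_filter kc => t ->.
split; first by rewrite E; apply: intbleD => //; exact: intble_cst.
rewrite E IgD//; last exact: intble_cst.
rewrite IgB//; last exact: intbleZ.
rewrite IgZ// Ig_cst; have -> : Ig (fun t => complex.Re (F t)) = 1.
  by have := congr1 (@complex.Re R) cF.
have : Ig (fun t => cmod (F t) ^+ 2) <= n2 W F.
  by apply: Ig_le => //; apply: ae01T => t; rewrite ler_peMr// sqr_ge0.
by move=> h; lra.
Qed.

End Szego.

Lemma ae01_forall (P : nat -> R -> Prop) : (forall n, ae01 (P n)) ->
  ae01 (fun t => forall n, P n t).
Proof.
move=> h; have := ae_foralln h.
by apply: (filterS (F := almost_everywhere mu)) => t ht It n; exact: ht.
Qed.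

(** The companion [u'] is meant for [u' = r u] with [|r| <= 1]: one multiplier must serve [u] and
    [r u] together. Elsewhere [u' = u]. *)
Lemma H1_L2_approx u u' (e : R) : H1 u -> H1 u' ->
  (forall t, cmod (u' t) <= cmod (u t)) -> 0 < e ->
  exists F, [/\ cmeasurable F, H1 (fun t => F t * u t), H1 (fun t => F t * u' t),
    L2w (fun=> 1) (fun t => F t * u t) & norm1 (fun t => F t * u t - u t) <= e].
Proof.
move=> hu hu' uu' e0; pose ep n : R := 2^-1 ^+ n.
have ep0 n : 0 < ep n by rewrite exprn_gt0// invr_gt0.
have ep1 n : ep n <= 1 by rewrite exprn_ile1// ?invr_ge0// invf_le1// ler1n.
have /choice[F hF] := fun n => szego_min hu hu' uu' (ep0 n).
set K := norm1 u in hF; have K0 : 0 <= K := norm1_ge0 u.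
have mF n : cmeasurable (F n) by have [] := hF n.
have mu' := H1_meas hu.
(* The choice [eps = 2^-n] makes the squared distances of the multipliers to 1 summable, which
   upgrades [L2] convergence to convergence almost everywhere. *)
have cvF : ae01 (fun t => cmod (F n t - 1) ^+ 2 @[n --> \oo] --> (0 : R)).
  have : ae01 (fun t => cvgn (series (fun n => cmod (F n t - 1) ^+ 2))).
    apply: (@ae_summable R _ K K0) => [n|n t|n]; last 2 first.
    - exact: sqr_ge0.
    - by have [_ _ _ _ [_]] := hF n; rewrite mulrC.
    by have [_ _ _ _ []] := hF n.
  by apply: ae01_filter => t; exact: cvg_series_cvg_0.
(* [|F|^2 <= 1 + ep n * K <= 1 + K <= (1 + K)^2], a bound uniform in [n], as domination requires. *)
have bF : ae01 (fun t => forall n, cmod (F n t) <= 1 + K).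
  apply: ae01_forall => n; have [_ _ _ h _] := hF n.
  apply: ae01_filter h => t h; rewrite leNgt; apply/negP => h1.
  have := cmod_ge0 (u t); have := ep0 n; have := ep1 n => a1 a2 a3.
  have h2 : cmod (F n t) ^+ 2 <= cmod (F n t) ^+ 2 * (1 + ep n * cmod (u t)).
    by rewrite ler_peMr ?sqr_ge0// lerDl mulr_ge0// ltW.
  have h3 : ep n * K <= K by rewrite ler_piMl.
  by nra.
pose f_ n t := cmod (F n t * u t - u t).
have fE n t : f_ n t = cmod (F n t - 1) * cmod (u t) by rewrite -cmodM mulrBl mul1r.
have mf_ n : measurable_fun I (f_ n).
  by apply: cmeas_cmod; apply: cmeasB => //; exact: cmeasM.
have cvf : ae01 (fun t => f_ ^~ t @ \oo --> (0 : R)).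
  apply: ae01_filter cvF => t c; under eq_fun do rewrite fE.
  have := cvg_comp _ _ c (@sqrt_continuous R 0); rewrite sqrtr0.
  rewrite (_ : _ \o _ = (fun n => cmod (F n t - 1))); last first.
    by apply/funext => n /=; rewrite sqrtr_sqr ger0_norm// cmod_ge0.
  by move=> /cvgM /(_ (cvg_cst (cmod (u t)))); rewrite mul0r.
have bf : ae01 (fun t => forall n, `|f_ n t| <= (2 + K) * cmod (u t)).
  apply: ae01_filter bF => t h n; rewrite ger0_norm ?cmod_ge0// fE.
  rewrite ler_wpM2r ?cmod_ge0//; apply: le_trans (cmodB _ _) _.
  by rewrite cmod1; have := h n; lra.
have := Ig_dominated mf_ (measurable_cst (0 : R)) (intbleZ (2 + K) (L1_cmod (H1_L1 hu))) cvf bf.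
move=> /cvgr0Pnorm_le /(_ e e0) [N _ /(_ N (leqnn N)) /= hN].
have [_ h1 h2 h3 _] := hF N; exists (F N); split => //; last first.
  apply: le_trans (le_trans (ler_norm _) hN); rewrite /norm1 le_eqVlt; apply/orP; left.
  by apply/eqP; congr Ig; apply/funext => t; rewrite subr0 ger0_norm// cmod_ge0.
split; first exact: cmeasM.
(* Multiplying [|F|^2 (1 + eps |u|) <= 1 + eps K] by [|u|] and dropping [|F|^2 |u|] bounds [|F u|^2]
   by a multiple of the integrable [|u|]. *)
apply: (intble_le _ (intbleZ ((1 + ep N * K) / ep N) (L1_cmod (H1_L1 hu)))).
  apply: measurable_funM; last exact: measurable_cst.
  by apply: measurable_funX; apply: cmeas_cmod; exact: cmeasM.
apply: ae01_filter h3 => t h; rewrite mulr1 ger0_norm ?sqr_ge0// cmodM exprMn.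
have u0 := cmod_ge0 (u t).
rewrite [leRHS]mulrAC ler_pdivlMr//; apply: le_trans (ler_wpM2r u0 h).
have := sqr_ge0 (cmod (F N t)) => h4.
have : 0 <= cmod (F N t) ^+ 2 * cmod (u t) by rewrite mulr_ge0.
by move=> h5; nra.
Qed.

End OuterApproximation.

(** * Shift-invariant subspaces of [H2], products, and almost-everywhere nonvanishing *)

Section Beurling.
Variable R : realType.
Local Notation C := R[i].
Local Notation I := (@I01 R).
Local Notation one := (fun _ : R => 1 : R).
Implicit Types (f g F G u p q : R -> C).

Let one1 (t : R) : 1 <= one t. Proof. exact: lexx. Qed.
Let mone : measurable_fun I one. Proof. exact: measurable_cst. Qed.

Lemma L2_zpow p (n : int) : L2w one p -> L2w one (fun t => zpow n t * p t).
Proof.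
move=> [mp hp]; split; first by apply: cmeasM => //; exact: cmeas_zpow.
by under eq_fun do rewrite cmodM cmod_zpow mul1r.
Qed.

Lemma L2_bounded p (M : R) : cmeasurable p -> ae01 (fun t => cmod (p t) <= M) -> L2w one p.
Proof.
move=> mp pM; split => //; apply: (intble_le _ (intble_cst (M ^+ 2))).
  exact: (measurable_sqrW mone mp).
apply: ae01_filter pM => t h; rewrite mulr1 ger0_norm ?sqr_ge0//.
by rewrite lerXn2r ?nnegrE ?cmod_ge0// (le_trans _ h)// cmod_ge0.
Qed.

Lemma H1_closed_H2 F (P : (R -> C) -> Prop) : L2w one F ->
  (forall G, P G -> L2w one G) -> (forall G, P G -> H1 G) ->
  (forall e, 0 < e -> exists2 G, P G & n2 one (fun t => F t - G t) <= e) -> H1 F.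
Proof.
move=> hF PL PH h.
have := H1_closedL2 one1 mone hF PL (cmeas_cst 1) (intble_cst 1) (fun=> ler01) _ _ h.
under eq_fun do rewrite mulr1; apply => [t|G /PH].
  by rewrite cmod1 expr1n mulr1.
by under eq_fun do rewrite mulr1.
Qed.

(* Minimize the norm over the [p] in [M] whose [N]-th Fourier coefficient is 1, where [N]
   is the least index at which [M] does not vanish: the minimizer is orthogonal to [z M]. *)
Lemma beurling (M : (R -> C) -> Prop) :
  (forall p, M p -> H1 p) -> (forall p, M p -> L2w one p) ->
  (forall p q (c : C), M p -> M q -> M (fun t => p t + c * q t)) ->
  (forall p, M p -> M (fun t => zpow 1 t * p t)) ->
  (forall F, L2w one F ->
    (forall e, 0 < e -> exists2 G, M G & n2 one (fun t => F t - G t) <= e) -> M F) ->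
  (exists2 p, M p & ~ ae01 (fun t => p t = 0)) ->
  exists J, [/\ M J, ae01 (fun t => cmod (J t) = 1) &
    forall p, M p -> forall n : nat, cint (fun t => conjc (J t) * (zpow n.+1 t * p t)) = 0].
Proof.
move=> MH ML MD Mz Mcl [p0 Mp0 p0n].
have M0 : M (fun=> 0).
  have := MD _ _ (-1) Mp0 Mp0; rewrite (_ : (fun t => _) = (fun=> 0))//.
  by apply/funext => t; rewrite mulN1r subrr.
have MZ c p : M p -> M (fun t => c * p t).
  by move=> Mp; have := MD _ _ c M0 Mp; under eq_fun do rewrite add0r.
have Mzn (n : nat) p : M p -> M (fun t => zpow n t * p t).
  move=> Mp; elim: n => [|n ih]; first by under eq_fun do rewrite zpow0 mul1r.
  have := Mz _ ih; rewrite (_ : (fun t => _) = (fun t => zpow n.+1 t * p t))//.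
  by apply/funext => t; rewrite mulrA -zpowD.
pose P (n : nat) := `[< exists2 p, M p & fourier p (n : int) <> 0 >].
have exP : exists n, P n.
  apply: contrapT => hP; apply: p0n; apply: fourier_unique => [|k].
    exact/H1_L1/MH.
  case: k => [n|n]; last by have [_] := MH _ Mp0; apply.
  apply: contrapT => h; apply: hP; exists n; apply/asboolP.
  by exists p0.
have [N /asboolP[q Mq qN] Nmin] := ex_minnP exP.
have low p (k : int) : M p -> (k < N)%R -> fourier p k = 0.
  move=> Mp; case: k => [n|n] kN; last by have [_] := MH _ Mp; apply.
  apply: contrapT => h; have : (N <= n)%N by apply: Nmin; apply/asboolP; exists p.
  by rewrite leqNgt => /negP; apply.
pose A p := M p /\ cint (fun t => p t * zpow (- (N : int)) t) = 1.
have fE p k : fourier p k = cint (fun t => p t * zpow (- k) t).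
  by rewrite fourierE; congr cint; apply/funext => t; rewrite mulrC.
have L1z p k : M p -> L1 (fun t => p t * zpow k t).
  move=> Mp; under eq_fun do rewrite mulrC; exact/L1_zpow/H1_L1/MH.
have cD p g (c : C) k : M p -> M g -> cint (fun t => (p t + c * g t) * zpow k t) =
    cint (fun t => p t * zpow k t) + c * cint (fun t => g t * zpow k t).
  move=> Mp Mg; rewrite -cintZ; last exact: L1z.
  rewrite -cintD; [|exact: L1z|exact/L1Z/L1z].
  by congr cint; apply/funext => t; rewrite mulrDl mulrA.
have AL p : A p -> L2w one p by case=> /ML.
have [|//|F G [MF cF] [MG cG]|F lF hF|J0 [MJ cJ] Jmin] := @min_exists R one one1 mone A.
- exists (fun t => (fourier q N)^-1 * q t); split; first exact: MZ.
  under eq_fun do rewrite -mulrA; rewrite cintZ; last exact: L1z.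
  by rewrite -fE mulVf//; exact/eqP.
- rewrite (_ : (fun t => _) = (fun t => 2^-1 * F t + 2^-1 * G t)); last first.
    by apply/funext => t; field.
  split; first by apply: MD => //; exact: MZ.
  rewrite cD//; last exact: MZ.
  under eq_fun do rewrite -mulrA; rewrite cintZ; last exact: L1z.
  by rewrite cF cG; field.
- split.
    by apply: Mcl => // e /hF[G [MG _] hG]; exists G.
  apply: (cint_closedL2 one1 mone lF AL (cmeas_zpow _ _) (intble_cst 1)
    (fun=> ler01) _ _ hF) => [t|G [//]].
  by rewrite cmod_zpow expr1n mulr1.
have orth p : M p -> cint (fun t => conjc (J0 t) * (zpow 1 t * p t)) = 0.
  move=> Mp; have Mzp := Mz _ Mp.
  have := min_orthogonal one1 mone (ML _ MJ) (ML _ Mzp) Jmin.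
  have -> : (fun t => conjc (zpow 1 t * p t) * J0 t * (1%:C)%C) =
      (fun t => conjc (conjc (J0 t) * (zpow 1 t * p t))).
    by apply/funext => t; rewrite rmorph1 mulr1 [in RHS]conjcM conjcK mulrC.
  have hL : L1 (fun t => conjc (J0 t) * (zpow 1 t * p t)).
    have := L2w_inner one1 mone (ML _ Mzp) (ML _ MJ).
    by under eq_fun do rewrite rmorph1 mulr1.
  rewrite cint_conj// => h.
  have /(congr1 (@conjc R)) : conjc (cint (fun t => conjc (J0 t) * (zpow 1 t * p t))) = 0.
    apply: h => c; split; first exact: MD.
    (* The [N]-th coefficient of [z p] is the one of [p] at [N - 1], zero by minimality of [N]; so
       the perturbation respects the constraint. *)
    rewrite cD// cJ (_ : (fun t => _) = (fun t => p t * zpow (- ((N : int) - 1)) t)).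
      by rewrite -fE low ?mulr0 ?addr0// ltrBlDr ltrDl.
    apply/funext => t; rewrite opprB addrC [in RHS]zpowD.
    by rewrite [in RHS]mulrC mulrAC [zpow 1 t * _]mulrC.
  by rewrite conjcK conjc0.
have orthn p (n : nat) : M p -> cint (fun t => conjc (J0 t) * (zpow n.+1 t * p t)) = 0.
  move=> Mp; rewrite -(orth _ (Mzn n _ Mp)); congr cint; apply/funext => t.
  by rewrite [zpow 1 t * _]mulrA -zpowD.
have [mJ iJ] := ML _ MJ.
have iJ2 : intble (fun t => cmod (J0 t) ^+ 2).
  by move: iJ; under eq_fun do rewrite mulr1.
have hk : H1 (fun t => (cmod (J0 t) ^+ 2)%:C%C).
  apply/H1P; split=> [|n]; first exact: L1_real.
  rewrite -(orthn _ n MJ); congr cint; apply/funext => t.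
  by rewrite -mulc_conj; ring.
(* [|J0|^2] is constant. The constant is not 0, because the [N]-th coefficient of [J0] is 1, and [s]
   rescales it to 1. *)
have kc := H1_real_const iJ2 hk; set c := Ig _ in kc.
have c0 : 0 < c.
  rewrite lt_neqAle Ig_ge0 ?andbT; last by move=> t; exact: sqr_ge0.
  apply/eqP => c0; have J00 : ae01 (fun t => J0 t = 0).
    apply: ae01_filter kc => t; rewrite -c0 => /eqP; rewrite sqrf_eq0 => /eqP.
    exact: cmod_eq0.
  have /eqP := cJ; rewrite (@cint_ae _ _ (fun=> 0)).
  - by rewrite cint_cst eq_sym oner_eq0.
  - by apply: cmeasM => //; exact: cmeas_zpow.
  - exact: cmeas_cst.
  by apply: ae01_filter J00 => t ->; rewrite mul0r.
pose s : R := (Num.sqrt c)^-1.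
have s0 : 0 < s by rewrite invr_gt0 sqrtr_gt0.
exists (fun t => s%:C%C * J0 t); split; first exact: MZ.
  apply: ae01_filter kc => t h; rewrite cmodM cmod_real gtr0_norm//.
  have -> : cmod (J0 t) = Num.sqrt c by rewrite -h sqrtr_sqr ger0_norm// cmod_ge0.
  by rewrite mulVf// gt_eqF// sqrtr_gt0.
move=> p Mp n; under eq_fun do rewrite conjcM conjc_real -mulrA.
rewrite cintZ ?orthn ?mulr0//.
have := L2w_inner one1 mone (L2_zpow n.+1 (ML _ Mp)) (ML _ MJ).
by under eq_fun do rewrite rmorph1 mulr1.
Qed.

(** Among the errors [e] in [H2] for which [(p - e) q] is in [H1], take one of least norm. Each
    [z^n q] is in [H1], so [e] may be varied along every [z^n]; hence [e] is orthogonal to all of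
    them and vanishes. *)
Lemma H2_mul p q : H1 p -> L2w one p -> H1 q -> L2w one q -> H1 (fun t => p t * q t).
Proof.
move=> hp lp hq lq.
have iq : intble (fun t => cmod (q t) ^+ 2 * 1) by case: lq.
have q0 t : 0 <= cmod (q t) ^+ 2 * 1 by rewrite mulr1 sqr_ge0.
have qW t : cmod (q t) ^+ 2 <= cmod (q t) ^+ 2 * 1 * 1 by rewrite !mulr1.
have L1q F : L2w one F -> L1 (fun t => F t * q t).
  by move=> lF; exact: (L2w_L1 one1 lF (H1_meas hq) iq q0 qW).
pose B e := [/\ L2w one e, H1 e & H1 (fun t => (p t - e t) * q t)].
have BL e : B e -> L2w one e by case.
have [|//|F G [lF hF pF] [lG hG pG]|F lF hF|e [le he pe] emin] := @min_exists R one one1 mone B.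
- exists p; split => //; under eq_fun do rewrite subrr mul0r; exact: H1_one.
- rewrite (_ : (fun t => _) = (fun t => 2^-1 * F t + 2^-1 * G t)); last first.
    by apply/funext => t; field.
  split; first by apply: L2wD => //; exact: L2wZ.
    by apply: H1D => //; exact: H1Z.
  rewrite (_ : (fun t => _) =
    (fun t => 2^-1 * ((p t - F t) * q t) + 2^-1 * ((p t - G t) * q t))).
    by apply: H1D => //; exact: H1Z.
  by apply/funext => t; field.
- split => //.
    by apply: (H1_closed_H2 lF BL _ hF) => G [].
  apply: H1_closed => [|d d0]; first by apply: L1q; exact: L2wB.
  have [G BG hG] := L2w_small_norm1 one1 mone lF BL (H1_meas hq) iq q0 qW hF d0.
  exists (fun t => (p t - G t) * q t); first by case: BG.
  apply: le_trans hG; rewrite /norm1 le_eqVlt; apply/orP; left; apply/eqP; congr Ig.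
  by apply/funext => t; rewrite cmodBC; congr cmod; ring.
have e0 : ae01 (fun t => e t = 0).
  apply: fourier_unique => [|k]; first exact: H1_L1.
  case: k => [n|n]; last by have [_] := he; apply.
  have lz : L2w one (@zpow R n).
    apply: (@L2_bounded _ 1); first exact: cmeas_zpow.
    by apply: ae01T => t; rewrite cmod_zpow.
  have := min_orthogonal one1 mone le lz emin.
  under eq_fun do rewrite rmorph1 mulr1 conj_zpow.
  rewrite fourierE; apply => c.
  have hz : H1 (@zpow R n).
    have := H1_zpow n (H1_one (1 : C)); rewrite (_ : (fun t => zpow n t * 1) = @zpow R n)//.
    by apply/funext => t; rewrite mulr1.
  split; first by apply: L2wD => //; exact: L2wZ.
    by apply: H1D => //; exact: H1Z.
  rewrite (_ : (fun t => _) = (fun t => (p t - e t) * q t - c * (zpow n t * q t))).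
    by apply: H1B => //; apply: H1Z; exact: H1_zpow.
  by apply/funext => t; ring.
apply: (H1_ae pe); first by apply: cmeasM; exact: H1_meas.
by apply: ae01_filter e0 => t ->; rewrite subr0.
Qed.

(** A bounded [H1] function is in [H2]; [u] is an [L1] limit of [H2] functions [F u], to which
    [H2_mul] applies. *)
Lemma H1_mul_bounded f u (M : R) : H1 f -> ae01 (fun t => cmod (f t) <= M) -> H1 u ->
  H1 (fun t => f t * u t).
Proof.
move=> hf fM hu; have mf := H1_meas hf.
have fM' : ae01 (fun t => cmod (f t) <= `|M| + 1).
  by apply: ae01_filter fM => t h; have := ler_norm M; lra.
have M0 : 0 < `|M| + 1 by have := normr_ge0 M; lra.
apply: H1_closed => [|e e0]; first by apply: (L1M mf fM); exact: H1_L1.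
have e' : 0 < e / (`|M| + 1) by rewrite divr_gt0.
have [F [mF hF _ lF nF]] := H1_L2_approx hu hu (fun t => lexx _) e'.
exists (fun t => f t * (F t * u t)).
  by apply: H2_mul => //; exact: L2_bounded fM.
apply: (@le_trans _ _ ((`|M| + 1) * norm1 (fun t => F t * u t - u t))).
  rewrite /norm1 -IgZ; last by apply: L1_cmod; apply: L1B; exact: H1_L1.
  apply: Ig_le.
  - apply: L1_cmod; apply: L1B; apply: (L1M mf fM); exact: H1_L1.
  - by apply: intbleZ; apply: L1_cmod; apply: L1B; exact: H1_L1.
  apply: ae01_filter fM' => t h; rewrite -mulrBr cmodM cmodBC.
  by rewrite ler_wpM2r ?cmod_ge0.
by rewrite mulrC -ler_pdivlMr.
Qed.

(** On the zero set of [u] the approximant [G] vanishes, so the integral of [|F|^2] there is at most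
    the squared distance from [F] to [G]. *)
Lemma vanish_closed u F (P : (R -> C) -> Prop) : cmeasurable u -> L2w one F ->
  (forall G, P G -> L2w one G) -> (forall G, P G -> ae01 (fun t => u t = 0 -> G t = 0)) ->
  (forall e, 0 < e -> exists2 G, P G & n2 one (fun t => F t - G t) <= e) ->
  ae01 (fun t => u t = 0 -> F t = 0).
Proof.
move=> mu' lF PL Pu h; have [mF iF] := lF.
pose k t : R := cmod (F t) ^+ 2 * (if cmod (u t) == 0 then 1 else 0).
have mk : measurable_fun I k.
  apply: measurable_funM; first by apply: measurable_funX; exact: cmeas_cmod.
  apply: measurable_fun_if; try exact: measurable_cst; first exact: measurable_I01.
  by apply: measurable_fun_eqr; [exact: cmeas_cmod|exact: measurable_cst].
have k0 t : 0 <= k t by rewrite mulr_ge0 ?sqr_ge0//; case: ifP.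
have ik : intble k.
  apply: (intble_le mk iF); apply: ae01T => t; rewrite ger0_norm// mulr1 /k.
  by case: ifP; rewrite ?mulr1// mulr0 sqr_ge0.
suff /(Ig_eq0 ik k0) : Ig k = 0.
  apply: ae01_filter => t kt ut; move: kt.
  by rewrite /k ut cmod0 eqxx mulr1 => /eqP; rewrite sqrf_eq0 => /eqP; exact: cmod_eq0.
apply/eqP; rewrite eq_le Ig_ge0// andbT; apply/ler_addgt0Pl => e e0; rewrite addr0.
have [G PG hG] := h e e0; apply: le_trans hG; apply: Ig_le => //.
  by have [] := L2wB one1 mone lF (PL _ PG).
apply: ae01_filter (Pu _ PG) => t; rewrite /k mulr1.
case: ifP => [/eqP/cmod_eq0 ut /(_ ut) ->|_ _]; first by rewrite mulr1 subr0.
by rewrite mulr0 sqr_ge0.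
Qed.

(** The [H2] functions vanishing wherever [u] does form a closed shift-invariant subspace, nonzero
    because it contains approximants [F u]. It therefore contains a unimodular function, and the
    zero set of [u] must be null. *)
Lemma H1_nonzero_ae u : H1 u -> ~ ae01 (fun t => u t = 0) -> ae01 (fun t => u t <> 0).
Proof.
move=> hu un; have mu' := H1_meas hu.
pose M p := [/\ H1 p, L2w one p & ae01 (fun t => u t = 0 -> p t = 0)].
have ML p : M p -> L2w one p by case.
have [||||F lF hF||J [[_ _ Ju] J1 _]] := @beurling M.
- by move=> p [].
- by [].
- move=> p q c [hp lp vp] [hq lq vq]; split.
  + by apply: H1D => //; exact: H1Z.
  + by apply: L2wD => //; exact: L2wZ.
  by apply: (ae01_filter2 _ vp vq) => t h1 h2 ut; rewrite h1// h2// mulr0 addr0.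
- move=> p [hp lp vp]; split; [exact: H1_zpow|exact: L2_zpow|].
  by apply: ae01_filter vp => t h ut; rewrite h// mulr0.
- split => //.
    by apply: (H1_closed_H2 lF ML _ hF) => G [].
  by apply: (vanish_closed mu' lF ML _ hF) => G [].
- have n0 : 0 < norm1 u.
    rewrite lt_neqAle norm1_ge0 andbT; apply/eqP => /esym n0.
    by apply: un; apply: norm1_eq0 => //; exact: H1_L1.
  have e0 : 0 < norm1 u / 2 by rewrite divr_gt0.
  have [F [mF hF _ lF nF]] := H1_L2_approx hu hu (fun t => lexx _) e0.
  exists (fun t => F t * u t).
    by split => //; apply: ae01T => t ->; rewrite mulr0.
  move=> Fu; suff : norm1 u <= norm1 u / 2 by lra.
  apply: le_trans nF; rewrite le_eqVlt; apply/orP; left; apply/eqP.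
  rewrite -[RHS](@norm1_ae _ (fun t => - u t)).
  + by congr Ig; apply/funext => t; rewrite cmodN.
  + exact: cmeasN.
  + by apply: cmeasB => //; exact: cmeasM.
  by apply: ae01_filter Fu => t ->; rewrite sub0r.
apply: (ae01_filter2 _ Ju J1) => t h1 h2 ut.
by move: h2; rewrite h1// cmod0 => /eqP; rewrite eq_sym oner_eq0.
Qed.

End Beurling.

(** * Real quotients, common inner divisors, and division by outer functions *)

Section InnerDivisors.
Variable R : realType.
Local Notation C := R[i].
Local Notation I := (@I01 R).
Local Notation one := (fun _ : R => 1 : R).
Implicit Types (f g F G u p q J : R -> C).

Let one1 (t : R) : 1 <= one t. Proof. exact: lexx. Qed.
Let mone : measurable_fun I one. Proof. exact: measurable_cst. Qed.

Lemma norm1E f : norm1 f = Ig (fun t => cmod (f t)). Proof. by []. Qed.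

Lemma invc_unimodular (z : C) : cmod z = 1 -> z^-1 = conjc z.
Proof. by move=> h; rewrite invc_conj h expr1n invr1 mul1r. Qed.

Lemma conjc_mul_unimodular (z : C) : cmod z = 1 -> conjc z * z = 1.
Proof. by move=> h; rewrite mulrC mulc_conj h expr1n. Qed.

Lemma H1_div_inner u J : cmeasurable u -> cmeasurable J -> ae01 (fun t => cmod (J t) = 1) ->
  H1 (fun t => conjc (J t) * u t) -> H1 (fun t => u t / J t).
Proof.
move=> mu' mJ J1 h; apply: (H1_ae h); first by apply: cmeasM => //; exact: cmeasV.
by apply: ae01_filter J1 => t h1; rewrite invc_unimodular// mulrC.
Qed.

Lemma norm1B_lt_nonzero u v : L1 u -> L1 v -> norm1 (fun t => v t - u t) < norm1 u ->
  ~ ae01 (fun t => v t = 0).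
Proof.
move=> hu hv; rewrite ltNge => /negP h v0; apply: h.
rewrite le_eqVlt; apply/orP; left; apply/eqP.
rewrite -[RHS](@norm1_ae _ (fun t => - u t)).
- by congr Ig; apply/funext => t; rewrite cmodN.
- exact/cmeasN/L1_meas.
- by apply: cmeasB => //; exact: L1_meas.
by apply: ae01_filter v0 => t ->; rewrite sub0r.
Qed.

Lemma norm1_gt0 u : L1 u -> ~ ae01 (fun t => u t = 0) -> 0 < norm1 u.
Proof.
move=> hu un; rewrite lt_neqAle norm1_ge0 andbT; apply/eqP => /esym n0.
by apply: un; exact: norm1_eq0.
Qed.

(* For real [r], the [p] in [H2] with [r p] in [H2] form a shift-invariant subspace; its
   Beurling inner function is the minimal denominator of [r], constant only if [r] is. *)
Lemma common_inner_divisor (r : R -> R) u0 : measurable_fun I r -> (forall t, `|r t| <= 1) ->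
  H1 u0 -> H1 (fun t => (r t)%:C%C * u0 t) -> ~ ae01 (fun t => u0 t = 0) ->
  (forall c : R, ~ ae01 (fun t => r t = c)) ->
  exists J, [/\ inner J, nonconstant J &
    forall u, H1 u -> H1 (fun t => (r t)%:C%C * u t) -> H1 (fun t => u t / J t)].
Proof.
move=> mr r1 hu0 hru0 u0n rn.
have mrC := cmeas_real mr.
have rle u t : cmod ((r t)%:C%C * u t) <= cmod (u t).
  by rewrite cmodM cmod_real ler_piMl ?cmod_ge0.
pose M p := [/\ H1 p, L2w one p & H1 (fun t => (r t)%:C%C * p t)].
have ML p : M p -> L2w one p by case.
have approx u (e : R) : H1 u -> H1 (fun t => (r t)%:C%C * u t) -> 0 < e ->
    exists2 p, M p & norm1 (fun t => p t - u t) <= e.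
  move=> hu hru e0.
  have [F [mF hF hrF lF nF]] := H1_L2_approx hu hru (rle u) e0.
  exists (fun t => F t * u t) => //; split => //.
  rewrite (_ : (fun t => _) = (fun t => F t * ((r t)%:C%C * u t)))//.
  by apply/funext => t; rewrite mulrCA.
have [||||F lF hF||J [[hJ lJ hrJ] J1 Jorth]] := @beurling R M.
- by move=> p [].
- by [].
- move=> p q c [hp lp vp] [hq lq vq]; split.
  + by apply: H1D => //; exact: H1Z.
  + by apply: L2wD => //; exact: L2wZ.
  under eq_fun do rewrite mulrDr mulrCA.
  by apply: H1D => //; exact: H1Z.
- move=> p [hp lp vp]; split; [exact: H1_zpow|exact: L2_zpow|].
  under eq_fun do rewrite mulrCA; exact: H1_zpow.
- split => //.
    by apply: (H1_closed_H2 lF ML _ hF) => G [].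
  under eq_fun do rewrite mulrC.
  apply: (H1_closedL2 one1 mone lF ML mrC (intble_cst 1) (fun=> ler01) _ _ hF) => [t|G].
    by rewrite cmod_real mulr1 exprn_ile1.
  by case=> _ _; under eq_fun do rewrite mulrC.
- have n0 := norm1_gt0 (H1_L1 hu0) u0n.
  have e0 : 0 < norm1 u0 / 2 by rewrite divr_gt0.
  have [p Mp np] := approx u0 _ hu0 hru0 e0.
  exists p => //; apply: (norm1B_lt_nonzero (H1_L1 hu0)).
    by case: Mp => /H1_L1.
  by apply: le_lt_trans np _; lra.
have mJ := H1_meas hJ; have mcJ := cmeas_conj mJ.
have cJ1 : ae01 (fun t => cmod (conjc (J t)) <= 1).
  by apply: ae01_filter J1 => t; rewrite cmod_conj => ->.
exists J; split.
- split => //; split; last by case: hJ.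
  by split => //; exists 1; apply: ae01_filter J1 => t ->.
(* If [J] is a unimodular constant [c], then [r] is [conj c] times [r J], a real function in [H1],
   hence constant. *)
- move=> [c Jc]; apply: (rn (Ig r)); apply: H1_real_const.
    by apply: (intble_le mr (intble_cst 1)); exact: ae01T.
  apply: (H1_ae (H1Z (conjc c) hrJ)) => //.
  apply: (ae01_filter2 _ Jc J1) => t h1 h2.
  by rewrite -h1 mulrCA conjc_mul_unimodular ?mulr1.
move=> u hu hru; apply: H1_div_inner => //; first exact: H1_meas.
(* Divisibility by [J] is known for elements of [M] only; it extends to [u] because [M] approximates
   [u] in [L1] and multiplication by [conj J] does not increase the norm. *)
apply: H1_closed => [|e e0]; first by apply: (L1M mcJ cJ1); exact: H1_L1.
have [p Mp np] := approx u _ hu hru e0; have [hp lp hrp] := Mp.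
exists (fun t => conjc (J t) * p t).
  apply/H1P; split=> [|n]; first by apply: (L1M mcJ cJ1); exact: H1_L1.
  by rewrite -(Jorth _ Mp n); congr cint; apply/funext => t; rewrite mulrCA.
apply: le_trans np; apply: Ig_le.
- by apply: L1_cmod; apply: L1B; apply: (L1M mcJ cJ1); exact: H1_L1.
- by apply: L1_cmod; apply: L1B; exact: H1_L1.
apply: ae01_filter cJ1 => t h; rewrite -mulrBr cmodM cmodBC.
by rewrite ler_piMl ?cmod_ge0.
Qed.

Lemma K1D phi f g (c : C) : K1 phi f -> K1 phi g -> K1 phi (fun t => f t + c * g t).
Proof.
move=> [hf hf'] [hg hg']; split; first by apply: H1D => //; exact: H1Z.
rewrite (_ : (fun t => _) = (fun t => conjc (zid t * phi t * f t) +
    conjc c * conjc (zid t * phi t * g t))).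
  by apply: H1D => //; exact: H1Z.
by apply/funext => t; rewrite -conjcM -rmorphD /=; congr conjc; ring.
Qed.

Lemma K1_meas phi f : K1 phi f -> cmeasurable f.
Proof. by move=> [/H1_meas]. Qed.

Lemma K1_L1 phi f : K1 phi f -> L1 f.
Proof. by move=> [/H1_L1]. Qed.

(** With [a = h + d] and [b = h - d], the parallelogram law and the hypothesis on the sum give
    [|a| |b| = |h|^2 - |d|^2]. Squaring leaves no room for an imaginary part of [d conj h], so
    [d / h] is real. *)
Lemma cmod_aligned (a b h : C) : h = (a + b) / 2 -> cmod a + cmod b = 2 * cmod h -> h <> 0 ->
  let r := complex.Re ((a - b) / 2 * conjc h) / cmod h ^+ 2 in
  `|r| <= 1 /\ (a - b) / 2 = r%:C%C * h.
Proof.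
move=> hE hn h0 r; pose d := (a - b) / 2.
have h1 : 0 < cmod h ^+ 2.
  by rewrite exprn_even_gt0//=; apply/eqP => /cmod_eq0.
have dE : d = (a - b) / 2 by [].
have aE : a = h + d by rewrite hE dE; field.
have bE : b = h - d by rewrite hE dE; field.
have par : cmod a ^+ 2 + cmod b ^+ 2 = 2 * cmod h ^+ 2 + 2 * cmod d ^+ 2.
  by rewrite aE bE cmod_parallelogram.
have dh : cmod d <= cmod h.
  rewrite -(ler_pXn2r (_ : 0 < 2)%N) ?nnegrE ?cmod_ge0//.
  have : 0 <= cmod a * cmod b by rewrite mulr_ge0 ?cmod_ge0.
  by move=> ?; nra.
have prod : cmod a * cmod b = cmod h ^+ 2 - cmod d ^+ 2 by nra.
have im0 : complex.Im (d * conjc h) = 0.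
  pose x := complex.Re (d * conjc h); pose y := complex.Im (d * conjc h).
  have a2 : cmod a ^+ 2 = cmod h ^+ 2 + cmod d ^+ 2 + 2 * x.
    by rewrite aE /x !cmod_sqr !(Re_add, Im_add, Re_mul, Re_conjc, Im_conjc); ring.
  have b2 : cmod b ^+ 2 = cmod h ^+ 2 + cmod d ^+ 2 - 2 * x.
    rewrite bE /x !cmod_sqr !(Re_add, Im_add, Re_opp, Im_opp, Re_mul, Re_conjc, Im_conjc).
    by ring.
  have xy : x ^+ 2 + y ^+ 2 = cmod d ^+ 2 * cmod h ^+ 2.
    by rewrite -cmod_sqr cmodM cmod_conj exprMn.
  have /eqP : y ^+ 2 = 0.
    have : cmod a ^+ 2 * cmod b ^+ 2 = (cmod h ^+ 2 - cmod d ^+ 2) ^+ 2.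
      by rewrite -prod exprMn.
    by rewrite a2 b2 => e; lra.
  by rewrite sqrf_eq0 => /eqP.
have re : d * conjc h = (complex.Re (d * conjc h))%:C%C.
  by apply: complex_ext.
split.
  rewrite normrM [X in _ * X]gtr0_norm ?invr_gt0// ler_pdivrMr// mul1r.
  apply: le_trans (Re_cmod _) _; rewrite cmodM cmod_conj expr2.
  by rewrite ler_wpM2r ?cmod_ge0.
rewrite -/d /r -/d rmorphM /= -re.
have -> : d * conjc h * ((cmod h ^+ 2)^-1)%:C%C * h =
    d * ((h * conjc h) * ((cmod h ^+ 2)^-1)%:C%C) by ring.
by rewrite mulc_conj -rmorphM /= mulfV ?gt_eqF// mulr1.
Qed.

(** The triangle defect is nonnegative and its integral is at most [1 + 1 - 2 * norm1 h = 0]. *)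
Lemma aligned_ae g1 g2 h : L1 g1 -> L1 g2 -> L1 h ->
  ae01 (fun t => h t = (g1 t + g2 t) / 2) ->
  norm1 g1 <= 1 -> norm1 g2 <= 1 -> norm1 h = 1 ->
  ae01 (fun t => cmod (g1 t) + cmod (g2 t) = 2 * cmod (h t)).
Proof.
move=> L1g1 L1g2 L1h hE n1 n2 nh.
pose k t := cmod (g1 t) + cmod (g2 t) - cmod (g1 t + g2 t).
have i1 := L1_cmod L1g1; have i2 := L1_cmod L1g2; have i3 := L1_cmod (L1D L1g1 L1g2).
have i12 := intbleD i1 i2.
have n12 : Ig (fun t => cmod (g1 t + g2 t)) = 2.
  have ih := L1_cmod L1h.
  have -> : 2 = Ig (fun t => 2 * cmod (h t)) by rewrite IgZ// -norm1E nh mulr1.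
  apply: Ig_ae; [exact: intble_meas|exact: (intble_meas (intbleZ 2 ih))|].
  apply: ae01_filter hE => t ->; rewrite cmodM.
  have -> : (2^-1 : C) = (2^-1 : R)%:C%C by rewrite fmorphV rmorph_nat.
  by rewrite cmod_real ger0_norm ?invr_ge0//; field.
have k0 t : 0 <= k t by rewrite subr_ge0 cmodD.
have ik : intble k by exact: intbleB.
have : Ig k = 0.
  apply/eqP; rewrite eq_le Ig_ge0// andbT IgB// IgD// n12.
  by move: n1 n2; rewrite /norm1 -!/(Ig _) => ? ?; lra.
move=> /(Ig_eq0 ik k0) h0; apply: (ae01_filter2 _ h0 hE) => t kt ->.
rewrite cmodM; have -> : (2^-1 : C) = (2^-1 : R)%:C%C by rewrite fmorphV rmorph_nat.
by rewrite cmod_real ger0_norm ?invr_ge0//; rewrite /k in kt; lra.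
Qed.

(** The form fits two uses: two minimizers of one coset with their midpoint [h], and minimizers of
    two cosets whose average is the given coset. *)
Lemma rel_prime_extreme phi g1 g2 h : K1 phi g1 -> K1 phi g2 -> K1 phi h ->
  ae01 (fun t => h t = (g1 t + g2 t) / 2) ->
  norm1 g1 <= 1 -> norm1 g2 <= 1 -> norm1 h = 1 ->
  rel_prime_inner h (fun t => conjc (zid t * phi t * h t)) ->
  ae01 (fun t => g1 t = g2 t).
Proof.
move=> kg1 kg2 kh hE n1 n2 nh rp.
have al := aligned_ae (K1_L1 kg1) (K1_L1 kg2) (K1_L1 kh) hE n1 n2 nh.
have [hh hv] := kh; have L1h := H1_L1 hh; have mh := H1_meas hh.
have hn : ~ ae01 (fun t => h t = 0).
  move=> h0; have := nh; rewrite (norm1_ae mh (cmeas_cst 0) h0) /norm1.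
  under eq_fun do rewrite cmod0.
  by rewrite -/(Ig _) Ig_cst => /eqP; rewrite eq_sym oner_eq0.
have hnz := H1_nonzero_ae hh hn.
pose d t : C := (g1 t - g2 t) / 2.
have dE : d = (fun t => 2^-1 * g1 t + - 2^-1 * g2 t) by apply/funext => t; rewrite /d; ring.
have kd : K1 phi d.
  rewrite dE; have k0 : K1 phi (fun=> 0).
    have := K1D (-1) kh kh; rewrite (_ : (fun t => _) = (fun=> 0))//.
    by apply/funext => t; rewrite mulN1r subrr.
  have := K1D (- 2^-1) (K1D 2^-1 k0 kg1) kg2.
  by under eq_fun do rewrite add0r.
have [hd hd'] := kd; have md := H1_meas hd.
pose r0 t : R := complex.Re (d t * conjc (h t)) / cmod (h t) ^+ 2.
(* Clamping gives a quotient bounded at every point; almost everywhere it agrees with [r0]. *)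
pose r t : R := Num.max (-1) (Num.min 1 (r0 t)).
have mr0 : measurable_fun I r0.
  apply: measurable_funM; first by have [] := cmeasM md (cmeas_conj mh).
  apply: measurable_inv => [|t]; last exact: sqr_ge0.
  by apply: measurable_funX; exact: cmeas_cmod.
have mr : measurable_fun I r.
  apply: measurable_maxr; first exact: measurable_cst.
  by apply: measurable_minr => //; exact: measurable_cst.
have r1 t : `|r t| <= 1.
  by rewrite ler_norml /r le_max lexx /= ge_max ge_min lexx /= andbT; lra.
have dr : ae01 (fun t => d t = (r t)%:C%C * h t).
  apply: (ae01_filter3 _ al hE hnz) => t h1 h2 h3.
  have [] := cmod_aligned h2 h1 h3; rewrite -/(d t) -/(r0 t) => ler0 ->.
  congr (_%:C%C * _); move: ler0; rewrite ler_norml => /andP[l1 l2].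
  by rewrite /r (min_idPr l2) (max_idPr l1).
apply: contrapT => ne.
(* A constant ratio [c] would give norms [|1 + c|] and [|1 - c|], both at most 1 only for [c = 0],
   that is, for [g1 = g2] almost everywhere. *)
have rn (c : R) : ~ ae01 (fun t => r t = c).
  move=> rc; apply: ne.
  have dc : ae01 (fun t => d t = c%:C%C * h t) by apply: (ae01_filter2 _ dr rc) => t -> ->.
  have nrm g (a : R) : cmeasurable g -> ae01 (fun t => g t = a%:C%C * h t) -> norm1 g = `|a|.
    move=> mg ga; rewrite (norm1_ae mg _ ga); last by apply: cmeasM => //; exact: cmeas_cst.
    rewrite /norm1; under eq_fun do rewrite cmodM cmod_real.
    by rewrite -/(Ig _) IgZ; [rewrite -norm1E nh mulr1|exact: L1_cmod].
  have e1 : norm1 g1 = `|1 + c|.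
    apply: nrm; first exact: K1_meas kg1.
    apply: (ae01_filter2 _ dc hE) => t h1 h2.
    by rewrite rmorphD /= mulrDl mul1r -h1 h2 /d; field.
  have e2 : norm1 g2 = `|1 - c|.
    apply: nrm; first exact: K1_meas kg2.
    apply: (ae01_filter2 _ dc hE) => t h1 h2.
    by rewrite rmorphB /= mulrBl mul1r -h1 h2 /d; field.
  have c0 : c = 0.
    have := ler_norm (1 + c); have := ler_norm (1 - c).
    by move: n1 n2; rewrite e1 e2 => *; lra.
  apply: ae01_filter dc => t; rewrite c0 mul0r /d => /eqP.
  by rewrite mulf_eq0 invr_eq0 pnatr_eq0 orbF subr_eq0 => /eqP.
have mrh u : cmeasurable u -> cmeasurable (fun t => (r t)%:C%C * u t).
  by move=> mu'; apply: cmeasM => //; exact: cmeas_real.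
have hr : H1 (fun t => (r t)%:C%C * h t) by apply: (H1_ae hd) => //; exact: mrh.
(* Because [r] is real it passes through the conjugation, so the companion of [d] is [r] times the
   companion of [h]. *)
have hrv : H1 (fun t => (r t)%:C%C * conjc (zid t * phi t * h t)).
  apply: (H1_ae hd'); first exact/mrh/H1_meas.
  apply: ae01_filter dr => t ->.
  by rewrite -[in RHS](conjc_real (r t)) -conjcM; congr conjc; ring.
have [J [iJ nJ Jdiv]] := common_inner_divisor mr r1 hh hr hn rn.
by apply: rp; exists J; split => //; split => //; split; exact: Jdiv.
Qed.

(** The partial sums [X N] of the Neumann series are in [H1], and the remainder [q^N g / (1 - q)]
    tends to 0 in [L1]. *)
Lemma H1_geometric (q g : R -> C) (rho : R) : H1 q -> ae01 (fun t => cmod (q t) <= rho) ->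
  0 <= rho < 1 -> H1 g -> H1 (fun t => g t / (1 - q t)).
Proof.
move=> hq qr /andP[r0 r1] hg.
have mq := H1_meas hq; have mg := H1_meas hg.
have lb t : cmod (q t) <= rho -> 1 - rho <= cmod (1 - q t).
  move=> h; have := cmodD (1 - q t) (q t); rewrite subrK cmod1 => h1; lra.
have nz t : cmod (q t) <= rho -> 1 - q t != 0.
  by move=> /lb h; apply/eqP => e0; move: h; rewrite e0 cmod0; lra.
have r1' : 0 < 1 - rho by lra.
pose X N := iter N (fun X t => g t + q t * X t) (fun=> 0).
have hX N : H1 (X N).
  elim: N => [|N ih]; first exact: H1_one.
  by apply: H1D => //; exact: (H1_mul_bounded hq qr).
have XE N t : g t - (1 - q t) * X N t = q t ^+ N * g t.
  elim: N => [|N ih] /=; first by rewrite mulr0 subr0 expr0 mul1r.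
  by rewrite exprS -mulrA -ih -/(X N); ring.
have m1q : cmeasurable (fun t => (1 - q t)^-1).
  by apply: cmeasV; apply: cmeasB => //; exact: cmeas_cst.
have b1q : ae01 (fun t => cmod (1 - q t)^-1 <= (1 - rho)^-1).
  apply: ae01_filter qr => t h; rewrite cmodV lef_pV2 ?posrE//; first exact: lb.
  exact: lt_le_trans (lb _ h).
have L1g : L1 (fun t => g t / (1 - q t)).
  by under eq_fun do rewrite mulrC; apply: (L1M m1q b1q); exact: H1_L1.
apply: H1_closed => // e e0; have K0 := norm1_ge0 g.
have cv : (1 - rho)^-1 * norm1 g * rho ^+ n @[n --> \oo] --> (0 : R).
  have : rho ^+ n @[n --> \oo] --> (0 : R) by apply: cvg_expr; rewrite ger0_norm.
  by move=> /(cvgM (cvg_cst ((1 - rho)^-1 * norm1 g))); rewrite mulr0.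
have /cvgr0Pnorm_le /(_ e e0) [N _ /(_ N (leqnn N)) /= hN] := cv.
exists (X N) => //; apply: le_trans (le_trans (ler_norm _) hN).
have -> : (1 - rho)^-1 * norm1 g * rho ^+ N = ((1 - rho)^-1 * rho ^+ N) * norm1 g by ring.
have iK : intble (fun t => (1 - rho)^-1 * rho ^+ N * cmod (g t)).
  exact/intbleZ/L1_cmod/H1_L1.
rewrite -IgZ; last exact/L1_cmod/H1_L1.
apply: Ig_le => //; first by apply: L1_cmod; apply: L1B => //; exact: H1_L1.
apply: (ae01_filter2 _ qr b1q) => t h h'.
have -> : g t / (1 - q t) - X N t = (1 - q t)^-1 * (q t ^+ N * g t).
  by rewrite -XE; field; exact: nz.
rewrite !cmodM mulrA ler_wpM2r ?cmod_ge0//; apply: ler_pM => //; try exact: cmod_ge0.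
elim: (N) => [|m ih]; first by rewrite !expr0 cmod1.
by rewrite !exprS cmodM; apply: ler_pM => //; exact: cmod_ge0.
Qed.

(* [1 + z] is outer for inner [z], since [(1 + z) / (1 + r z) -> 1] boundedly as [r -> 1]. *)
Lemma H1_div_outer (z x : R -> C) : H1 z -> ae01 (fun t => cmod (z t) = 1) ->
  ae01 (fun t => 1 + z t <> 0) -> L1 x -> H1 (fun t => (1 + z t) * x t) -> H1 x.
Proof.
move=> hz z1 zn hx hzx; have mz := H1_meas hz; have mx := L1_meas hx.
pose dl n : R := 2^-1 ^+ n.+1.
have dl0 n : 0 < dl n by rewrite exprn_gt0// invr_gt0.
have dl1 n : dl n < 1 by rewrite exprn_ilt1 ?invr_ge0// invf_lt1// ltr1n.
pose X n t := (1 + z t) * x t / (1 - (- (1 - dl n)%:C%C) * z t).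
have hX n : H1 (X n).
  apply: (@H1_geometric _ _ (1 - dl n)) => //; first exact: H1Z.
    apply: ae01_filter z1 => t h; rewrite cmodM h mulr1 cmodN cmod_real ger0_norm//.
    by rewrite subr_ge0 ltW.
  by have := dl0 n; have := dl1 n; lra.
(* With [w = 1 + (1 - dl n) z] the error is [x dl z / w]. From [|w| >= dl n] comes the domination by
   [|x|]; from [|1 + z| <= 2 |w|] comes pointwise convergence. *)
have key n t : cmod (z t) = 1 -> 1 + z t <> 0 ->
    [/\ cmod (X n t - x t) <= cmod (x t) &
      cmod (X n t - x t) <= cmod (x t) * (2 / cmod (1 + z t)) * dl n].
  move=> h h0; set w : C := 1 - (- (1 - dl n)%:C%C) * z t.
  have w1 : 1 + z t = w + (dl n)%:C%C * z t by rewrite /w rmorphB /= rmorph1; ring.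
  have dw : dl n <= cmod w.
    have := cmodD w (- w + 1); rewrite addrA subrr add0r cmod1.
    rewrite /w opprB subrK cmodM cmodN cmod_real h mulr1 ger0_norm ?subr_ge0 ?(ltW (dl1 n))//.
    by lra.
  have w0 : 0 < cmod w by exact: lt_le_trans (dl0 n) dw.
  have wn : w != 0 by apply/eqP => e; move: w0; rewrite e cmod0 ltxx.
  have Lw : cmod (1 + z t) <= 2 * cmod w.
    rewrite w1; apply: le_trans (cmodD _ _) _.
    by rewrite cmodM cmod_real h mulr1 gtr0_norm//; lra.
  have L0 : 0 < cmod (1 + z t).
    by rewrite lt_neqAle cmod_ge0 andbT eq_sym; apply/eqP => /cmod_eq0.
  have E : cmod (X n t - x t) = cmod (x t) * (dl n / cmod w).
    have -> : X n t - x t = x t * ((dl n)%:C%C * z t / w).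
      by rewrite /X -/w w1; field.
    by rewrite !cmodM cmodV h mulr1 cmod_real gtr0_norm.
  rewrite E; split.
    by rewrite ler_piMr ?cmod_ge0// ler_pdivrMr// mul1r.
  rewrite -mulrA ler_wpM2l ?cmod_ge0// mulrC ler_wpM2r ?(ltW (dl0 n))//.
  by rewrite ler_pdivlMr// mulrC ler_pdivrMr.
apply: H1_closed => // e e0.
pose f_ n t := cmod (X n t - x t).
have mf_ n : measurable_fun I (f_ n).
  by apply: cmeas_cmod; apply: cmeasB => //; exact: H1_meas.
have cvf : ae01 (fun t => f_ ^~ t @ \oo --> (0 : R)).
  apply: (ae01_filter2 _ z1 zn) => t h1 h2.
  have c : cmod (x t) * (2 / cmod (1 + z t)) * dl n @[n --> \oo] --> (0 : R).
    have : dl n @[n --> \oo] --> (0 : R).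
      have := @cvg_expr R 2^-1; rewrite ger0_norm ?invr_ge0// invf_lt1// ltr1n => /(_ isT).
      by move=> /(cvg_shift_addl 1).
    by move=> /(cvgM (cvg_cst (cmod (x t) * (2 / cmod (1 + z t))))); rewrite mulr0.
  apply: (squeeze_cvgr _ (cvg_cst (0 : R)) c); near=> n.
  by rewrite cmod_ge0 /=; have [] := key n t h1 h2.
have bf : ae01 (fun t => forall n, `|f_ n t| <= cmod (x t)).
  apply: (ae01_filter2 _ z1 zn) => t h1 h2 n.
  by rewrite ger0_norm ?cmod_ge0//; have [] := key n t h1 h2.
have := Ig_dominated mf_ (measurable_cst (0 : R)) (L1_cmod hx) cvf bf.
move=> /cvgr0Pnorm_le /(_ e e0) [N _ /(_ N (leqnn N)) /= hN].
exists (X N) => //; apply: le_trans (le_trans (ler_norm _) hN).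
rewrite /norm1 le_eqVlt; apply/orP; left; apply/eqP; congr Ig; apply/funext => t.
by rewrite subr0 ger0_norm ?cmod_ge0// cmodBC.
Unshelve. all: by end_near. Qed.

End InnerDivisors.

(** * Cosets, minimizers, and perturbation by a common inner divisor *)

Section QuotientSpace.
Variable R : realType.
Local Notation C := R[i].
Local Notation I := (@I01 R).
Implicit Types (f g h phi psi J : R -> C).

Lemma K1_zero phi : K1 phi (fun _ : R => 0).
Proof.
split; first exact: H1_one.
by under eq_fun do rewrite mulr0 conjc0; exact: H1_one.
Qed.

Lemma Espace_zero phi psi : Espace phi psi (fun _ : R => 0).
Proof.
split; first exact: K1_zero.
by exists (fun=> 0); split; [exact: H1_one|apply: ae01T => t; rewrite mulr0].
Qed.

Lemma Espace_lin phi psi f g (c : C) : Espace phi psi f -> Espace phi psi g ->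
  Espace phi psi (fun t => f t + c * g t).
Proof.
move=> [kf [f' [hf' ff']]] [kg [g' [hg' gg']]]; split; first exact: K1D.
exists (fun t => f' t + c * g' t); split; first by apply: H1D => //; exact: H1Z.
by apply: (ae01_filter2 _ ff' gg') => t -> ->; ring.
Qed.

(** Functions are not identified modulo null sets, so a.e. equality has to be converted into
    membership in the subspace. *)
Lemma Espace_ae0 phi psi f : K1 phi f -> ae01 (fun t => f t = 0) -> Espace phi psi f.
Proof.
move=> kf f0; split => //; exists (fun=> 0); split; first exact: H1_one.
by apply: ae01_filter f0 => t ->; rewrite mulr0.
Qed.

Lemma qnorm_le (Y : (R -> C) -> Prop) f y : Y y -> qnorm Y f <= norm1 (fun t => f t + y t).
Proof.
move=> Yy; apply: ge_inf; last by exists y.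
by exists 0 => _ [z [_ ->]]; exact: norm1_ge0.
Qed.

Lemma qnorm_le_coset (Y : (R -> C) -> Prop) f h : Y (fun t => h t - f t) ->
  qnorm Y f <= norm1 h.
Proof.
move=> /(qnorm_le f); rewrite (_ : (fun t => f t + _) = h)//.
by apply/funext => t; rewrite addrC subrK.
Qed.

Lemma K1_Mset phi psi f h : K1 phi f -> Mset (Espace phi psi) f h -> K1 phi h.
Proof.
move=> kf [[khf _] _]; have := K1D 1 kf khf; rewrite (_ : (fun t => _) = h)//.
by apply/funext => t; rewrite mul1r addrC subrK.
Qed.

(** For nonzero [a] the choice [b = i conj a / |a|] gives [b a = i |a|]. *)
Lemma unimodular_rotation (a : C) : exists2 b : C, cmod b = 1 & complex.Re (b * a) = 0.
Proof.
have [->|a0] := eqVneq a 0; first by exists 1; rewrite ?cmod1 ?mulr0.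
have na : cmod a != 0 by apply/eqP => /cmod_eq0 /eqP; rewrite (negbTE a0).
exists (Complex 0 1 * (conjc a * (cmod a)^-1%:C%C)).
  rewrite !cmodM cmod_conj cmod_real normfV ger0_norm ?cmod_ge0// mulfV// mulr1.
  by rewrite /cmod /= expr0n add0r expr1n sqrtr1.
have -> : Complex 0 1 * (conjc a * (cmod a)^-1%:C%C) * a =
    Complex 0 1 * ((a * conjc a) * (cmod a)^-1%:C%C) :> C by ring.
by rewrite mulc_conj -rmorphM /= mul0r mul1r subr0.
Qed.

Lemma inner_H1 J : inner J -> H1 J.
Proof.
move=> [[[mJ _] cJ] J1]; split => //; apply: (@L1_bounded _ _ 1) => //.
by apply: ae01_filter J1 => t ->.
Qed.

(* If [1 + b^2 J^2] vanished, [i b J] would be real-valued, hence constant. *)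
Lemma inner_square_nonzero J (b : C) : inner J -> nonconstant J -> cmod b = 1 ->
  ae01 (fun t => 1 + b ^+ 2 * (J t * J t) <> 0).
Proof.
move=> iJ nJ b1; have hJ := inner_H1 iJ; have [_ J1] := iJ; have mJ := H1_meas hJ.
have J1' : ae01 (fun t => cmod (J t) <= 1) by apply: ae01_filter J1 => t ->.
(* As an [H1] function, [1 + b^2 J^2] is nonzero almost everywhere as soon as it is not null. *)
apply: H1_nonzero_ae.
  by apply: H1D; [exact: H1_one|apply: H1Z; exact: (H1_mul_bounded hJ J1')].
move=> w0; apply: nJ.
have ib : conjc b * b = 1 by exact: conjc_mul_unimodular.
pose q t := complex.Re (- Complex 0 1 * b * J t).
have qE : ae01 (fun t => - Complex 0 1 * b * J t = (q t)%:C%C).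
  apply: ae01_filter w0 => t h; apply: complex_ext => //=.
  set s : C := - Complex 0 1 * b * J t.
  have s2 : s ^+ 2 = 1.
    rewrite /s (_ : (- Complex 0 1 * b * J t) ^+ 2 =
      Complex 0 1 ^+ 2 * (b ^+ 2 * (J t * J t))); last by ring.
    by rewrite sqr_i mulN1r; apply/eqP; rewrite eq_sym -subr_eq0 opprK; apply/eqP.
  have /orP[/eqP ->|/eqP ->] : (s == 1) || (s == -1) by rewrite -sqrf_eq1 s2.
    by [].
  by rewrite /= oppr0.
have hq : H1 (fun t => (q t)%:C%C).
  apply: (H1_ae (H1Z (- Complex 0 1 * b) hJ)) => //.
  apply: cmeas_real.
  by have [] := cmeasM (cmeas_cst (- Complex 0 1 * b)) mJ.
have iq : intble q by apply: L1_Re; exact: L1Z (H1_L1 hJ).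
have qc := H1_real_const iq hq.
exists (conjc b * Complex 0 1 * (Ig q)%:C%C).
apply: (ae01_filter2 _ qE qc) => t h <-; rewrite -h.
have -> : conjc b * Complex 0 1 * (- Complex 0 1 * b * J t) =
    (conjc b * b) * - (Complex 0 1 ^+ 2) * J t by ring.
by rewrite ib sqr_i opprK !mul1r.
Qed.

Lemma extreme_rel_prime phi psi f h : inner psi -> K1 phi f ->
  qnorm (Espace phi psi) f = 1 -> extreme_coset (K1 phi) (Espace phi psi) f ->
  Mset (Espace phi psi) f h ->
  rel_prime_inner h (fun t => conjc (zid t * phi t * h t)).
Proof.
move=> ipsi kf qf [_ ext] Mh [J [iJ [nJ [hk hk']]]].
set E := Espace phi psi in qf ext Mh; have kh := K1_Mset kf Mh.
have [Ehf nh] := Mh; rewrite qf in nh; have [hh hv] := kh.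
set v := (fun t => conjc (zid t * phi t * h t)) in hk' hv.
have mh := H1_meas hh; have mv := H1_meas hv.
have hJ := inner_H1 iJ; have [_ J1] := iJ; have mJ := H1_meas hJ.
have J1' : ae01 (fun t => cmod (J t) <= 1) by apply: ae01_filter J1 => t ->.
have hpsi := inner_H1 ipsi; have [_ psi1] := ipsi; have mpsi := H1_meas hpsi.
(* With this [b] the integral of [s |h|] is zero for [s = Re (b J)]. *)
have [b b1 ba] := unimodular_rotation (cint (fun t => J t * (cmod (h t))%:C%C)).
have bb : b * conjc b = 1 by rewrite mulrC; exact: conjc_mul_unimodular.
pose s t := complex.Re (b * J t).
have sE t : (s t)%:C%C = (b * J t + conjc b * conjc (J t)) / 2.
  by rewrite /s ReJ_add -conjcM.
have s1 : ae01 (fun t => `|s t| <= 1).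
  by apply: ae01_filter J1 => t Jt; apply: le_trans (Re_cmod _) _; rewrite cmodM b1 Jt mulr1.
have ms : measurable_fun I s by have [] := cmeasM (cmeas_cst b) mJ.
have msC := cmeas_real ms.
have Jinv : ae01 (fun t => (J t)^-1 = conjc (J t)).
  by apply: ae01_filter J1 => t; exact: invc_unimodular.
(* On the circle [1 / J = conj J], so [s u] is half of [b J u + conj b (u / J)]; dividing [u] by [J]
   handles the conjugate term. *)
have hs u : H1 u -> H1 (fun t => u t / J t) -> H1 (fun t => (s t)%:C%C * u t).
  move=> hu huJ; apply: (H1_ae (H1D (H1Z (b / 2) (H1_mul_bounded hJ J1' hu))
    (H1Z (conjc b / 2) huJ))); first by apply: cmeasM => //; exact: H1_meas.
  by apply: ae01_filter Jinv => t ->; rewrite sE; field.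
pose p t := (s t)%:C%C * h t.
have hp : H1 p by exact: hs.
have kp : K1 phi p.
  split => //; rewrite (_ : (fun t => _) = (fun t => (s t)%:C%C * v t)); first exact: hs.
  by apply/funext => t; rewrite /p /v -(conjc_real (s t)) -conjcM conjc_real; congr conjc; ring.
have int0 : Ig (fun t => s t * cmod (h t)) = 0.
  have L1Jh : L1 (fun t => J t * (cmod (h t))%:C%C).
    by apply: (L1M mJ J1'); apply: L1_real; exact/L1_cmod/H1_L1.
  rewrite -ba -cintZ//=; congr Ig; apply/funext => t.
  by rewrite mulrA Re_mul /= mulr0 subr0.
have ih : intble (fun t => cmod (h t)) by exact/L1_cmod/H1_L1.
have ish : intble (fun t => s t * cmod (h t)).
  apply: (intble_le _ ih); first by apply: measurable_funM => //; exact: cmeas_cmod.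
  apply: ae01_filter s1 => t h1; rewrite normrM [X in _ * X]ger0_norm ?cmod_ge0//.
  by rewrite ler_piMl ?cmod_ge0.
(* Since [|s| <= 1], the modulus of [1 + c s] is [1 + c s] itself for [c = 1] and [c = -1], and the
   integral of [s |h|] drops out. *)
have nrm (c : R) : `|c| = 1 -> norm1 (fun t => h t + c%:C%C * p t) = 1.
  move=> c1; rewrite -nh /norm1 -!/(Ig _).
  have -> : Ig (fun t => cmod (h t)) = Ig (fun t => cmod (h t) + c * (s t * cmod (h t))).
    by rewrite IgD ?IgZ ?int0 ?mulr0 ?addr0//; exact: intbleZ.
  apply: Ig_ae.
  - apply: cmeas_cmod; apply: cmeasD => //.
    by apply: cmeasM; [exact: cmeas_cst|exact: H1_meas].
  - by apply: intble_meas; apply: intbleD => //; exact: intbleZ.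
  apply: ae01_filter s1 => t h1.
  have -> : h t + c%:C%C * p t = (1 + c * s t)%:C%C * h t.
    by rewrite /p rmorphD rmorphM /= rmorph1; ring.
  rewrite cmodM cmod_real ger0_norm; first by ring.
  have : `|c * s t| <= 1 by rewrite normrM c1 mul1r.
  by rewrite ler_norml => /andP[? _]; lra.
have kg c : K1 phi (fun t => h t + c * p t) by exact: K1D.
have qg (c : R) : `|c| = 1 -> qnorm E (fun t => h t + c%:C%C * p t) <= 1.
  move=> c1; rewrite -(nrm c c1); apply: qnorm_le_coset.
  under eq_fun do rewrite subrr; exact: Espace_zero.
have := ext _ _ (kg 1%:C%C) (kg (-1)%:C%C) (qg 1 (normr1 _)) (qg (-1) (normrN1 _)).
have -> : (fun t => f t - (h t + 1%:C%C * p t + (h t + (-1)%:C%C * p t)) / 2) =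
    (fun t => 0 + (-1) * (h t - f t)).
  by apply/funext => t; rewrite rmorphN rmorph1; field.
have -> : (fun t => h t + 1%:C%C * p t - (h t + (-1)%:C%C * p t)) = (fun t => 2 * p t).
  by apply/funext => t; rewrite rmorphN rmorph1; ring.
move=> /(_ (Espace_lin (-1) (Espace_zero phi psi) Ehf)) [_ [g [hg pg]]].
(* Extremality gave [2 s h = psi g]. Multiplying by [b conj psi] yields [(1 + b^2 J^2) x = b g], and
   the outer factor can be divided out once [x] is known to be integrable. *)
pose k t := h t / J t.
pose x t := conjc (psi t) * k t.
have psi1' : ae01 (fun t => cmod (conjc (psi t)) <= 1).
  by apply: ae01_filter psi1 => t; rewrite cmod_conj => ->.
have L1x : L1 x by apply: (L1M (cmeas_conj mpsi) psi1'); exact: H1_L1.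
have Jn0 : ae01 (fun t => J t != 0).
  apply: ae01_filter J1 => t h1; apply/eqP => J0; move: h1; rewrite J0 cmod0 => /eqP.
  by rewrite eq_sym oner_eq0.
have hx : H1 x.
  have hJJ : H1 (fun t => b ^+ 2 * (J t * J t)).
    by apply: H1Z; exact: (H1_mul_bounded hJ J1').
  apply: (H1_div_outer hJJ) => //.
  - by apply: ae01_filter J1 => t h1; rewrite !cmodM b1 h1 !mulr1.
  - exact: inner_square_nonzero.
  apply: (H1_ae (H1Z b hg)).
    by apply: cmeasM; [apply: cmeasD; [exact: cmeas_cst|exact: H1_meas]|exact: L1_meas].
  have := ae01_filter3 (fun t a b c => conj a (conj b c)) pg psi1 Jn0.
  apply: (ae01_filter2 _ Jinv) => t h3 [h1 [h2 h4]].
  have -> : g t = conjc (psi t) * (2 * p t).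
    by rewrite h1 mulrA conjc_mul_unimodular// mul1r.
  rewrite /p sE -h3 /x /k.
  have -> : b * (conjc (psi t) * (2 * ((b * J t + conjc b * (J t)^-1) / 2 * h t))) =
     conjc (psi t) * (b ^+ 2 * J t + (b * conjc b) * (J t)^-1) * h t by field.
  by rewrite bb; field.
(* [h = psi J x] lies in [psi H1]; the coset of [f] is then the zero coset, contradicting its norm
   1. *)
have Eh : E h.
  split => //; exists (fun t => J t * x t); split; first exact: (H1_mul_bounded hJ J1').
  apply: (ae01_filter2 _ psi1 Jn0) => t h1 h2; rewrite /x /k.
  have -> : psi t * (J t * (conjc (psi t) * (h t / J t))) =
    (conjc (psi t) * psi t) * (J t * (h t / J t)) by ring.
  by rewrite conjc_mul_unimodular// mul1r; field.
have : E (fun t => 0 - f t).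
  have := Espace_lin (-1) Ehf Eh; rewrite (_ : (fun t => _) = (fun t => 0 - f t))//.
  by apply/funext => t; ring.
move=> /(qnorm_le_coset); rewrite qf /norm1; under eq_fun do rewrite cmod0.
by rewrite -/(Ig _) Ig_cst => h1; lra.
Qed.

End QuotientSpace.

(** * The equivalence, by passing from cosets to norm-minimal representatives *)

Theorem theorem1p2 (R : realType) (phi psi f : R -> R[i]) :
  Linf phi ->
  (exists g, K1 phi g /\ ~ ae01 (fun t => g t = 0)) ->
  inner psi -> nonconstant psi ->
  proximinal (K1 phi) (Espace phi psi) ->
  K1 phi f ->
  qnorm (Espace phi psi) f = 1 ->
  (extreme_coset (K1 phi) (Espace phi psi) f <->
   exists h, K1 phi h /\ Mset (Espace phi psi) f h /\
     (forall xi, Mset (Espace phi psi) f xi -> ae01 (fun t => xi t = h t)) /\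
     rel_prime_inner h (fun t => conjc (zid t * phi t * h t))).
Proof.
move=> _ _ ipsi _ prox kf qf; set E := Espace phi psi in prox qf *.
(* The midpoint has norm at most 1 by the triangle inequality and at least 1 as a member of the
   coset of [f]. *)
have Mmid g1 g2 : K1 phi g1 -> K1 phi g2 -> norm1 g1 <= 1 -> norm1 g2 <= 1 ->
    E (fun t => (g1 t + g2 t) / 2 - f t) -> Mset E f (fun t => (g1 t + g2 t) / 2).
  move=> k1 k2 n1 n2 Em; split => //; apply/eqP; rewrite eq_le.
  rewrite (qnorm_le_coset Em) andbT qf.
  have i1 := L1_cmod (K1_L1 k1); have i2 := L1_cmod (K1_L1 k2).
  apply: (@le_trans _ _ (Ig (fun t => 2^-1 * (cmod (g1 t) + cmod (g2 t))))).
    apply: Ig_le.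
    - apply: L1_cmod; under eq_fun do rewrite mulrC; apply: L1Z.
      exact: (L1D (K1_L1 k1) (K1_L1 k2)).
    - by apply: intbleZ; exact: intbleD.
    apply: ae01T => t; rewrite cmodM mulrC (_ : (2^-1 : R[i]) = (2^-1 : R)%:C%C).
      by rewrite cmod_real ger0_norm ?invr_ge0// ler_wpM2l ?invr_ge0// cmodD.
    by rewrite fmorphV rmorph_nat.
  rewrite IgZ ?IgD//; last exact: intbleD.
  by rewrite -!norm1E; lra.
split=> [ext|[h [kh [Mh [hu rp]]]]].
  have [h Mh] := prox f kf; have kh := K1_Mset kf Mh.
  exists h; split => //; split => //; split; last exact: extreme_rel_prime Mh.
  move=> xi Mxi; have kxi := K1_Mset kf Mxi.
  have [Eh nh] := Mh; have [Exi nxi] := Mxi; rewrite qf in nh nxi.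
  have Mm : Mset E f (fun t => (xi t + h t) / 2).
    apply: Mmid => //; rewrite ?nh ?nxi//.
    have := Espace_lin 2^-1 (Espace_lin 2^-1 (Espace_zero phi psi) Exi) Eh.
    rewrite (_ : (fun t => _) = (fun t => (xi t + h t) / 2 - f t))//.
    by apply/funext => t; field.
  have [_ nm] := Mm; rewrite qf in nm.
  (* The midpoint of [xi] and [h] is itself a minimizer, so extremality of the coset makes it
     coprime to its own companion. *)
  apply: (rel_prime_extreme kxi kh (K1_Mset kf Mm)); rewrite ?nh ?nxi//.
    exact: ae01T.
  exact: extreme_rel_prime Mm.
split=> [|g1 g2 k1 k2 q1 q2 Eg]; first by rewrite qf.
(* Proximinality replaces [g1] and [g2] by representatives of norm at most 1. Their midpoint is a
   minimizer for [f], hence equals [h] by uniqueness. *)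
have [g1' M1] := prox _ k1; have [g2' M2] := prox _ k2.
have k1' := K1_Mset k1 M1; have k2' := K1_Mset k2 M2.
have [E1 n1] := M1; have [E2 n2] := M2.
rewrite -n1 in q1; rewrite -n2 in q2.
have Mm : Mset E f (fun t => (g1' t + g2' t) / 2).
  apply: Mmid => //.
  have := Espace_lin (-1) (Espace_lin 2^-1 (Espace_lin 2^-1 (Espace_zero phi psi) E1) E2) Eg.
  rewrite (_ : (fun t => _) = (fun t => (g1' t + g2' t) / 2 - f t))//.
  by apply/funext => t; field.
have [_ nh] := Mh; rewrite qf in nh.
have gg : ae01 (fun t => g1' t = g2' t).
  apply: (rel_prime_extreme k1' k2' kh _ q1 q2 nh rp).
  by apply: ae01_filter (hu _ Mm) => t ->.
have E0 : E (fun t => g1' t + (-1) * g2' t).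
  apply: Espace_ae0; first exact: K1D.
  by apply: ae01_filter gg => t ->; rewrite mulN1r subrr.
have := Espace_lin 1 (Espace_lin (-1) E2 E1) E0.
rewrite (_ : (fun t => _) = (fun t => g1 t - g2 t))//.
by apply/funext => t; ring.
Qed.
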